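(* Let $(T,d,\rho,\leq,\mu)$ be a structured compact real tree such that $\leq$ satisfies (Or1) and (Or2) and such that $\mu$ satisfies (Mes). Then there exists a unique $h\in\mathcal{H}$ satisfying (Min) such that $(T,d,\rho,\leq,\mu)$ and $(T_h,d_h,\rho_h,\leq_h,\mu_h)$ are equivalent. (All terms are defined in the context.)
   Context: **Real trees.** A metric space $(T,d)$ is a real tree if: (1) for all $\sigma,\sigma'\in T$ there is an isometry (distance-preserving map) $f_{\sigma,\sigma'}:[0,d(\sigma,\sigma')]\to T$ with $f_{\sigma,\sigma'}(0)=\sigma$ and $f_{\sigma,\sigma'}(d(\sigma,\sigma'))=\sigma'$; write $[\![\sigma,\sigma']\!]=f_{\sigma,\sigma'}([0,d(\sigma,\sigma')])$; (2) if $q:[0,1]\to T$ is continuous and injective then $q([0,1])=[\![q(0),q(1)]\!]$. A rooted compact real tree $(T,d,\rho)$ is a compact real tree with a distinguished point $\rho\in T$. **Structured trees.** A structured compact real tree $(T,d,\rho,\leq,\mu)$ is a compact real tree $(T,d)$ with a root $\rho$, a linear (total) order $\leq$ on $T$ and a finite Borel measure $\mu$ on $T$. Two such trees $(T,d,\rho,\leq,\mu)$ and $(T',d',\rho',\leq',\mu')$ are equivalent if there is an isometry $f$ from $(T,d)$ onto $(T',d')$ with $f(\rho)=\rho'$, with $f(\sigma_1)\leq' f(\sigma_2)$ whenever $\sigma_1\leq\sigma_2$, and with $\mu'=\mu\circ f^{-1}$. **Compatibility conditions.** - (Or1): for all $\sigma_1,\sigma_2\in T$, if $\sigma_1\in[\![\rho,\sigma_2]\!]$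 then $\sigma_1\leq\sigma_2$. - (Or2): if $\sigma_1\leq\sigma_2\leq\sigma_3$, then $\gamma\in[\![\rho,\sigma_2]\!]$, where $\gamma$ is the point defined by $[\![\rho,\gamma]\!]=[\![\rho,\sigma_1]\!]\cap([\![\rho,\sigma_2]\!]\cup[\![\rho,\sigma_3]\!])$. - (Mes): for all distinct $\sigma_1,\sigma_2\in T$ with $\sigma_1<\sigma_2$, $\mu(\{\sigma\in T:\sigma_1<\sigma<\sigma_2\})>0$. **Height functions.** For $M\geq 0$, $\mathcal{H}_M$ is the set of non-negative functions $h$ on $[0,M]$ that are left-continuous with right-limits and satisfy $h(0)=h(0+)=0$ and $h(t)-h(t+)\geq 0$ for $t\in[0,M)$ (conditions on right-limits are void if $M=0$). $\mathcal{H}=\bigcup_{M\ge 0}\mathcal{H}_M$, and $\zeta(h)=M$ for $h\in\mathcal{H}_M$. **Coding.** For $h\in\mathcal{H}_M$ and $s,t\in[0,M]$ set $m_h(s,t)=\inf_{r\in[s\wedge t,s\vee t]}h(r)$ and $d_h(s,t)=h(s)+h(t)-2m_h(s,t)$ (a pseudo-distance). Let $s\sim_h t$ iff $d_h(s,t)=0$, $T_h=[0,M]/\sim_h$ with the induced distance $d_h$, and $p_h:[0,M]\to T_h$ the canonical projection. $(T_h,d_h)$ is a compact real tree. Set $\rho_h=p_h(0)$; $\sigma\leq_h\sigma'$ iff $\inf p_h^{-1}(\{\sigma\})\leq\inf p_h^{-1}(\{\sigma'\})$ (a linear order); $\mu_h(A)=\lambda(p_h^{-1}(A))$ for Borel $A\subset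 T_h$, with $\lambda$ Lebesgue measure. **(Min).** For $\sigma\in T_h$ let $\ell(\sigma)=\inf p_h^{-1}(\{\sigma\})$ and $r(\sigma)=\inf\{t>\ell(\sigma): p_h(t)\neq\sigma\}$ ($t$ ranging over $[0,\zeta(h)]$, with $\inf\emptyset=\zeta(h)$). Set $F(h)=\bigcup_{\sigma\in T_h}[\ell(\sigma),r(\sigma)]$ and $S(h)=[0,\zeta(h)]\setminus F(h)$. The function $h$ satisfies (Min) if $\lambda(S(h))=0$. *)

(* Defs.v *)
From HB Require Import structures.
From mathcomp Require Import all_boot all_order all_algebra generic_quotient.
From mathcomp Require Import all_classical all_reals all_analysis.
From mathcomp Require Import lra.

Set Implicit Arguments.
Unset Strict Implicit.
Unset Printing Implicit Defensive.

Import Order.TTheory GRing.Theory Num.Theory.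
Import numFieldNormedType.Exports.

Local Open Scope classical_set_scope.
Local Open Scope ring_scope.

Section RealTrees.
Context {R : realType} {T : metricType R}.
Implicit Types (s t : T) (rho : T) (le : rel T).

(* Only the values of f on [0, d(s, t)] are constrained. *)
Definition geodesic s t (f : R -> T) : Prop :=
  [/\ {in `[0, mdist s t] &, forall a b, mdist (f a) (f b) = `|a - b|},
      f 0 = s & f (mdist s t) = t].

(* The range of a geodesic from s to t.  In a real tree all geodesics from s
   to t have the same range (apply the second axiom of [real_tree] to each of
   them), so the union below is the range of any one of them. *)
Definition segment s t : set T :=
  [set x | exists2 f, geodesic s t f & (f @` `[0, mdist s t]) x].

Definition linear_order le : Prop :=
  [/\ reflexive le, antisymmetric le, transitive le & total le].

Definition Or1 rho le : Prop :=
  forall s1 s2, segment rho s2 s1 -> le s1 s2.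

Definition Or2 rho le : Prop :=
  forall s1 s2 s3, le s1 s2 -> le s2 s3 ->
  forall g,
    segment rho g = segment rho s1 `&` (segment rho s2 `|` segment rho s3) ->
    segment rho s2 g.

Definition strict le : rel T := fun s t => (s != t) && le s t.

(* The order interval below is a Borel set when Or1 and Or2 hold: a connected
   component of T minus the segment from the root to s is open and lies
   entirely on one side of s. *)
Definition Mes le (mu : set T -> \bar R) : Prop :=
  forall s1 s2, strict le s1 s2 ->
    (0 < mu [set s | strict le s1 s /\ strict le s s2])%E.

End RealTrees.

Definition real_tree {R : realType} (T : metricType R) : Prop :=
  (forall s t : T, exists f, geodesic s t f) /\
  (forall q : R -> T,
     {within `[0, 1], continuous q} -> {in `[0, 1] &, injective q} ->
     q @` `[0, 1] = segment (q 0) (q 1)).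

(* The library's measurable types are pointed: T is pointed at its root. *)
Definition pointed_at {R : realType} {T : metricType R} (rho : T) : Type := T.

HB.instance Definition _ {R : realType} {T : metricType R} (rho : T) :=
  Choice.on (pointed_at rho).
HB.instance Definition _ {R : realType} {T : metricType R} (rho : T) :=
  isPointed.Build (pointed_at rho) rho.

Definition borel {R : realType} {T : metricType R} (rho : T) : Type :=
  g_sigma_algebraType (@open T : set (set (pointed_at rho))).

HB.instance Definition _ {R : realType} {T : metricType R} (rho : T) :=
  Measurable.on (borel rho).

Definition equivalent {R : realType} (T T' : metricType R)
    (rho : T) (le : rel T) (mu : set T -> \bar R)
    (rho' : T') (le' : rel T') (mu' : set T' -> \bar R) : Prop :=
  exists f : T -> T',
    [/\ forall x y, mdist (f x) (f y) = mdist x y,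
        range f = [set: T'],
        f rho = rho',
        forall x y, le x y -> le' (f x) (f y) &
        forall A : set T', <<s @open T' >> A -> mu' A = mu (f @^-1` A)].

(* A pair of M = zeta >= 0 and a function on [0, M] in H_M.  The function is
   extended by 0 outside [0, M], so that equality of two records means equality
   of the lengths and of the functions on [0, M]; the one-sided limits below
   only involve values in [0, M]. *)
Record height (R : realType) := Height {
  zeta : R;
  hval :> R -> R;
  zeta_ge0 : 0 <= zeta;
  hval_out : forall t, t \notin `[0, zeta] -> hval t = 0;
  hval_ge0 : forall t, t \in `[0, zeta] -> 0 <= hval t;
  hval_lcont : forall t, 0 < t <= zeta -> hval x @[x --> t^'-] --> hval t;
  hval_rlim : forall t, 0 <= t < zeta -> cvg (hval x @[x --> t^'+]);
  hval0 : hval 0 = 0;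
  hval0r : 0 < zeta -> hval x @[x --> 0^'+] --> (0 : R);
  hval_jump : forall t, 0 <= t < zeta ->
    0 <= hval t - lim (hval x @[x --> t^'+])
}.

Section Coding.
Context {R : realType} (h : height R).

Definition m_h (s t : R) : R :=
  inf (h @` `[Num.min s t, Num.max s t]).

Definition d_h (s t : R) : R := h s + h t - 2 * m_h s t.

Lemma height_ge0 t : 0 <= h t.
Proof.
by have [/hval_ge0//|/hval_out->] := boolP (t \in `[0, zeta h]).
Qed.

Lemma m_h_le s t r : Num.min s t <= r <= Num.max s t -> m_h s t <= h r.
Proof.
move=> rst; apply: ge_inf.
  by exists 0 => _ [x _ <-]; exact: height_ge0.
by exists r => //=; rewrite in_itv.
Qed.

Lemma le_m_h s t c :
  (forall r, Num.min s t <= r <= Num.max s t -> c <= h r) -> c <= m_h s t.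
Proof.
move=> H; apply: lb_le_inf.
  exists (h (Num.min s t)), (Num.min s t) => //=.
  by rewrite in_itv/= lexx/= ge_min le_max lexx.
by move=> _ [x /= + <-]; rewrite in_itv => /H.
Qed.

Lemma m_hC s t : m_h s t = m_h t s.
Proof. by rewrite /m_h minC maxC. Qed.

Lemma m_h_lel s t : m_h s t <= h s.
Proof. by apply: m_h_le; rewrite ge_min le_max lexx. Qed.

Lemma m_h_ler s t : m_h s t <= h t.
Proof. by rewrite m_hC; exact: m_h_lel. Qed.

Lemma d_hxx s : d_h s s = 0.
Proof.
rewrite /d_h; suff -> : m_h s s = h s by rewrite mulr_natl mulr2n subrr.
apply/le_anti; rewrite m_h_lel; apply: le_m_h => r.
by rewrite minxx maxxx => /le_anti <-.
Qed.

Lemma d_hC s t : d_h s t = d_h t s.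
Proof. by rewrite /d_h m_hC (addrC (h s)). Qed.

Lemma d_h_ge0 s t : 0 <= d_h s t.
Proof.
by rewrite /d_h mulr_natl mulr2n subr_ge0 lerD ?m_h_lel ?m_h_ler.
Qed.

Lemma d_h_triangle t s u : d_h s u <= d_h s t + d_h t u.
Proof.
have H : Num.min (m_h s t) (m_h t u) <= m_h s u.
  apply: le_m_h => r; rewrite ge_min => /andP[r1 r2]; rewrite ge_min.
  have [rst|rst] := boolP (Num.min s t <= r <= Num.max s t).
    by rewrite (m_h_le rst).
  suff -> : m_h t u <= h r by rewrite orbT.
  apply: m_h_le; move: r1 r2 rst; rewrite !ge_min !le_max.
  by case: (leP s r); case: (leP r s); case: (leP t r); case: (leP r t);
     case: (leP u r); case: (leP r u) => //= *; exfalso; lra.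
have h1 := m_h_lel t u; have h2 := m_h_ler s t.
by move: H; rewrite /d_h; case: (leP (m_h s t)) => _ H; lra.
Qed.

Definition dom := {t : R | t \in `[0, zeta h]}.

Lemma dom0_subproof : 0 \in `[0, zeta h].
Proof. by rewrite in_itv/= lexx zeta_ge0. Qed.

Definition dom0 : dom := exist _ 0 dom0_subproof.

Definition sim_h (s t : dom) : bool := d_h (val s) (val t) == 0.

Lemma sim_h_refl : reflexive sim_h.
Proof. by move=> s; rewrite /sim_h d_hxx. Qed.

Lemma sim_h_sym : symmetric sim_h.
Proof. by move=> s t; rewrite /sim_h d_hC. Qed.

Lemma sim_h_trans : transitive sim_h.
Proof.
move=> t s u /eqP st /eqP tu; rewrite /sim_h eq_le d_h_ge0 andbT.
by rewrite (le_trans (d_h_triangle (val t) _ _))// st tu addr0.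
Qed.

Canonical sim_h_equiv := EquivRel sim_h sim_h_refl sim_h_sym sim_h_trans.

Definition T_h := {eq_quot sim_h_equiv}%qT.

HB.instance Definition _ := Choice.on T_h.

Definition p_h (s : dom) : T_h := (\pi_({eq_quot sim_h_equiv}) s)%qT.

(* [dist_hE] shows that the choice of representatives is immaterial. *)
Definition dist_h (x y : T_h) : R := d_h (val (repr x)) (val (repr y)).

Lemma p_h_repr (x : T_h) : p_h (repr x) = x.
Proof. exact: reprK. Qed.

Lemma p_hP s t : p_h s = p_h t <-> d_h (val s) (val t) = 0.
Proof.
split=> [/eqmodP/eqP//|st]; apply/eqmodP; exact/eqP.
Qed.

Lemma dist_hE s t : dist_h (p_h s) (p_h t) = d_h (val s) (val t).
Proof.
have es : d_h (val (repr (p_h s))) (val s) = 0 by apply/p_hP; exact: p_h_repr.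
have et : d_h (val (repr (p_h t))) (val t) = 0 by apply/p_hP; exact: p_h_repr.
have := d_h_triangle (val s) (val (repr (p_h s))) (val (repr (p_h t))).
have := d_h_triangle (val t) (val s) (val (repr (p_h t))).
have := d_h_triangle (val (repr (p_h s))) (val s) (val t).
have := d_h_triangle (val (repr (p_h t))) (val (repr (p_h s))) (val t).
rewrite /dist_h (d_hC (val t) (val (repr _))) (d_hC (val s) (val (repr _))).
by rewrite es et => *; lra.
Qed.

Lemma dist_hxx x : dist_h x x = 0.
Proof. exact: d_hxx. Qed.

Lemma dist_h_positivity x y : dist_h x y = 0 -> x = y.
Proof. by move/p_hP; rewrite !p_h_repr. Qed.

Lemma dist_hC x y : dist_h x y = dist_h y x.
Proof. exact: d_hC. Qed.

Lemma dist_h_triangle y x z : dist_h x z <= dist_h x y + dist_h y z.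
Proof. exact: d_h_triangle. Qed.

HB.instance Definition _ := isMetric.Build R T_h
  dist_hxx dist_h_positivity dist_hC dist_h_triangle.

Definition rho_h : T_h := p_h dom0.

(* p_h^{-1}(A), as a set of reals *)
Definition preim_h (A : set T_h) : set R := val @` (p_h @^-1` A).

Definition ell_h (x : T_h) : R := inf (preim_h [set x]).

Definition le_h : rel T_h := fun x y => ell_h x <= ell_h y.

Definition mu_h (A : set T_h) : \bar R := lebesgue_measure (preim_h A).

Definition r_h (x : T_h) : R :=
  let A := [set t | ell_h x < t] `&` preim_h (~` [set x]) in
  if A == set0 then zeta h else inf A.

Definition F_h : set R := \bigcup_(x in [set: T_h]) `[ell_h x, r_h x]%classic.

Definition S_h : set R := `[0, zeta h] `\` F_h.

Definition Min : Prop := lebesgue_measure S_h = 0%E.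

End Coding.

(* Main.v *)
From HB Require Import structures.
Require Import Defs.
From mathcomp Require Import all_boot all_order all_algebra.
From mathcomp Require Import all_classical all_reals all_analysis.
From mathcomp Require Import measurable_realfun lra.
Import Order.TTheory GRing.Theory Num.Theory.
Import numFieldNormedType.Exports.
Set Implicit Arguments.
Unset Strict Implicit.
Unset Printing Implicit Defensive.
Local Open Scope classical_set_scope.
Local Open Scope ring_scope.

(** The tree is explored in the order [le], spending time [mu A] in a Borel set
    [A]. A point [s] is first visited at time [mass_before s], the mass of the
    points strictly before it, and the height function records the distance from
    the root to the current position.

    Ancestry is handled through the Gromov product, a continuous function of two
    points whose value is the height of their branch point. The axioms of real
    trees give its four-point inequality ([gromov_four_point]), and Or2 becomes a
    betweenness inequality ([order_gromov]): a common ancestor of two points is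
    an ancestor of every point between them in the order. With compactness,
    betweenness makes every monotone family of points converge
    ([directed_limit]). So the limit along the order of the points visited up to
    time [t] defines a position [p t], which inherits betweenness, is
    left-continuous, has right limits that are ancestors of [p t], and is at [s]
    at time [mass_before s]. The infimum over [[s, t]] of the height of the
    position is the height of the branch point of [p s] and [p t], because the
    points just above that branch point towards [p t] are first visited between
    [s] and [t] ([position_inf]). Hence the pseudo-distance coded by the height
    of the position is the distance between positions, and the tree it codes is
    isometric to [T].

    For the measures, the points having a given ancestor are visited during an
    interval of time whose length is the mass of this subtree
    ([position_in_subtree], [subtree_position], the latter by
    [mass_down_exit]). Subtrees are nested or disjoint and generate the Borel
    sets ([borel_subtrees]), so the time spent in any Borel set is its mass
    ([exploration_measure]). Consequently, for almost every [t], the position at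
    time [t] is the last point visited, which is (Min) ([min_coding]).

    Conversely let [h] satisfy (Min) and code the tree. At almost every time the
    current point has not been left since its first visit, so the first visit
    time of a point is the measure of the times spent strictly before it
    ([mu_h_before]), that is [mass_before], and the height at that time is the
    distance to the root. These values determine [h], because every time is
    either in the stay that follows a first visit, where [h] is constant, or a
    left limit of first visit times ([height_determined]). *)

(** * Preliminaries *)

Section RealLine.
Context {R : realType}.
Local Notation lambda := (@lebesgue_measure R).

Lemma inf_min (A : set R) a : A a -> lbound A a -> inf A = a.
Proof.
move=> Aa lbA; apply/le_anti; rewrite ge_inf//=; last by exists a.
by apply: lb_le_inf => //; exists a.
Qed.

Lemma lebesgue_measure_bnd (a b : R) (x y : bool) : a <= b ->
  lambda [set` Interval (BSide x a) (BSide y b)] = (b - a)%:E.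
Proof.
rewrite lebesgue_measure_itv /= lte_fin le_eqVlt => /predU1P[->|->//].
by rewrite ltxx subrr.
Qed.

(** Lebesgue measure is an outer measure on all sets of reals, which avoids
    measurability conditions on preimages under [p_h]. *)
Lemma le_lebesgue_measure (A B : set R) : A `<=` B -> (lambda A <= lambda B)%E.
Proof. by move=> AB; exact: le_outer_measure. Qed.

End RealLine.

Section Geodesics.
Context {R : realType} {T : metricType R}.
Implicit Types (r x y z s t u v : T) (a b c : R).

Lemma mdist_eq0 x y : mdist x y <= 0 -> x = y.
Proof.
by move=> d0; apply: mdist_positivity; apply/le_anti; rewrite d0 mdist_ge0.
Qed.

Lemma mdist_lip r x y : `|mdist r x - mdist r y| <= mdist x y.
Proof.
rewrite ler_norml; have := metric_triangle r x y; have := metric_triangle r y x.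
by rewrite (metric_sym y x) => *; apply/andP; split; lra.
Qed.

Lemma open_ballP (A : set T) :
  (forall x, A x -> exists2 e, 0 < e & forall y, mdist x y < e -> A y) -> open A.
Proof.
move=> H; rewrite openE => x /H[e e0 eA]; apply/nbhs_ballP.
by exists e => // y; rewrite ballEmdist; exact: eA.
Qed.

Lemma lipschitz_within_continuous (L : R) (q : R -> T) (D : set R) :
  0 < L -> (forall a b, D a -> D b -> mdist (q a) (q b) <= L * `|a - b|) ->
  {within D, continuous q}.
Proof.
move=> L0 qL; apply/subspace_continuousP => a Da.
apply/metricType_numDomainType.cvgrPdist_lt => e e0.
rewrite near_withinE; near=> b => Db; apply: le_lt_trans (qL _ _ Da Db) _.
rewrite mulrC -ltr_pdivlMr//; near: b.
exact: (@cvgr_dist_lt _ _ _ _ _ id a cvg_id _ (divr_gt0 e0 L0)).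
Unshelve. all: by end_near. Qed.

Lemma glue_lipschitz (f g : R -> T) c L :
  (forall a b, 0 <= a -> a <= b -> b <= c -> mdist (f a) (f b) <= b - a) ->
  (forall a b, c <= a -> a <= b -> b <= L -> mdist (g a) (g b) <= b - a) ->
  f c = g c -> 0 <= c <= L ->
  forall a b, 0 <= a -> a <= b -> b <= L ->
    mdist (if a <= c then f a else g a) (if b <= c then f b else g b) <= b - a.
Proof.
move=> fL gL fg /andP[c0 cL] a b a0 ab bL.
case: (leP a c) => ac; case: (leP b c) => bc.
- exact: fL.
- apply: le_trans (metric_triangle _ (f c) _) _.
  have := fL _ _ a0 ac (lexx c); have := gL _ _ (lexx c) (ltW bc) bL.
  by rewrite fg => *; lra.
- by have := le_trans ab bc; rewrite leNgt ac.
- by apply: gL => //; exact: ltW.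
Qed.

Lemma geodesic_mdist s t f a : geodesic s t f -> 0 <= a <= mdist s t ->
  mdist s (f a) = a /\ mdist (f a) t = mdist s t - a.
Proof.
move=> [fi f0 fD] /andP[a0 aD].
have D0 : 0 <= mdist s t by exact: mdist_ge0.
split.
  by rewrite -[in LHS]f0 fi ?in_itv/= ?lexx ?a0 ?aD// sub0r normrN ger0_norm.
rewrite -[in LHS]fD fi ?in_itv/= ?lexx ?a0 ?aD ?D0// distrC ger0_norm//.
by rewrite subr_ge0.
Qed.

Lemma segment_mdist s t x :
  segment s t x -> mdist s x + mdist x t = mdist s t.
Proof.
move=> [f fg [a /= + <-]]; rewrite in_itv/= => aD.
by have [-> ->] := geodesic_mdist fg aD; lra.
Qed.

(** Two geodesics meeting at a point of the metric interval glue to a curve of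
    length the distance between its ends; the triangle inequality then forces
    this curve to be an isometry. *)
Lemma mdist_geodesic s t x :
  (forall u v, exists f, geodesic u v f) ->
  mdist s x + mdist x t = mdist s t ->
  exists2 f, geodesic s t f & f (mdist s x) = x.
Proof.
move=> geo sxt.
have [f fg] := geo s x; have [g gg] := geo x t.
have c0 := mdist_ge0 s x; have d0 := mdist_ge0 x t.
set c := mdist s x in sxt c0 *; set D := mdist s t in sxt.
pose g' a := g (a - c).
have fc : f c = g' c by rewrite /g' subrr; case: fg => _ _ ->; case: gg.
have cD : 0 <= c <= D by rewrite c0/=; lra.
have fL a b : 0 <= a -> a <= b -> b <= c -> mdist (f a) (f b) <= b - a.
  move=> a0 ab bc; case: fg => fi _ _; rewrite fi ?in_itv/= -/c; last 2 first.
  - by rewrite a0; lra.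
  - by rewrite bc andbT; lra.
  by rewrite distrC ger0_norm ?subr_ge0.
have gL a b : c <= a -> a <= b -> b <= D -> mdist (g' a) (g' b) <= b - a.
  move=> a0 ab bc; case: gg => gi _ _; rewrite gi ?in_itv/=; last 2 first.
  - by apply/andP; split; lra.
  - by apply/andP; split; lra.
  by rewrite distrC ger0_norm; lra.
pose k a := if a <= c then f a else g' a.
have kL : forall a b, 0 <= a -> a <= b -> b <= D ->
  mdist (k a) (k b) <= b - a := glue_lipschitz fL gL fc cD.
have k0 : k 0 = s by rewrite /k c0; case: fg.
have kD : k D = t.
  rewrite /k; case: leP => [Dc|_].
    have E : D = c by lra.
    by rewrite E fc; case: gg => _ _ <-; congr g; lra.
  by rewrite /g'; case: gg => _ _ <-; congr g; lra.
have kE a b : 0 <= a -> a <= b -> b <= D -> mdist (k a) (k b) = b - a.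
  move=> a0 ab bD; apply/le_anti; rewrite kL//=.
  have := metric_triangle (k 0) (k a) (k D).
  have := metric_triangle (k a) (k b) (k D).
  have := kL 0 a (lexx _) a0 (le_trans ab bD).
  have := kL b D (le_trans a0 ab) bD (lexx _).
  by rewrite kD k0 -/D => *; lra.
exists k; last by rewrite /k lexx; case: fg.
split => // a b; rewrite !in_itv/= -/D => /andP[a0 aD] /andP[b0 bD].
have [ab|/ltW ba] := leP a b.
  by rewrite kE// distrC ger0_norm ?subr_ge0.
by rewrite metric_sym kE// ger0_norm ?subr_ge0.
Qed.

End Geodesics.

(** * Segments and branch points of a real tree *)

Section RealTreeGeometry.
Context {R : realType} {T : metricType R}.
Hypothesis treeT : real_tree T.
Implicit Types (x y z s t u v w : T) (a b c : R).

Lemma segmentP s t x : segment s t x <-> mdist s x + mdist x t = mdist s t.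
Proof.
split=> [/segment_mdist//|sxt].
have [f fg fx] := mdist_geodesic treeT.1 sxt.
exists f => //; exists (mdist s x) => //=.
by rewrite in_itv/= mdist_ge0/= -sxt lerDl mdist_ge0.
Qed.

(** The second axiom of real trees, for paths of any length. The bound on
    distances is one-sided because concatenations of geodesics, to which this
    applies, need not be isometric a priori. *)
Lemma arc_segment (k : R -> T) (L : R) : 0 < L ->
  {in `[0, L] &, forall a b, mdist (k a) (k b) <= `|a - b|} ->
  {in `[0, L] &, injective k} ->
  k @` `[0, L] = segment (k 0) (k L).
Proof.
move=> L0 kL kI; pose q a := k (L * a).
have sc a : a \in `[0, 1] -> L * a \in `[0, L].
  rewrite !in_itv/= => /andP[a0 a1]; rewrite mulr_ge0 ?(ltW L0)//=.
  by rewrite ger_pMr.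
have : q @` `[0, 1] = segment (q 0) (q 1).
  apply: treeT.2.
    apply: (lipschitz_within_continuous L0) => a b a01 b01.
    rewrite -[in leRHS](gtr0_norm L0) -normrM mulrBr.
    by apply: kL; exact: sc.
  move=> a b /sc a01 /sc b01 /(kI _ _ a01 b01).
  by apply: mulfI; exact: lt0r_neq0.
rewrite /q mulr0 mulr1 => <-; apply/seteqP; split => _ [a aD <-].
  exists (L^-1 * a); last by rewrite mulVKf ?gt_eqF.
  move: aD; rewrite /= !in_itv/= => /andP[a0 aL].
  by rewrite mulr_ge0 ?invr_ge0 ?(ltW L0)//= ler_pdivrMl// mulr1.
by exists (L * a) => //; exact: sc.
Qed.

(** A geodesic is an injective path, so the second axiom of real trees puts
    every point of the metric interval on it. *)
Lemma segment_inj s t u v :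
  mdist s u + mdist u t = mdist s t -> mdist s v + mdist v t = mdist s t ->
  mdist s u = mdist s v -> u = v.
Proof.
move=> su sv uv.
have [D0|D0] := ltP 0 (mdist s t); last first.
  have := mdist_ge0 s u; have := mdist_ge0 s v.
  have := mdist_ge0 u t; have := mdist_ge0 v t => *.
  by apply: mdist_eq0; apply: le_trans (metric_triangle u s v) _;
    rewrite (metric_sym u); lra.
have [f fg fu] := mdist_geodesic treeT.1 su.
have [fi f0 fD] := fg.
have : (f @` `[0, mdist s t]) v.
  rewrite (arc_segment D0) ?f0 ?fD; first by apply/segmentP.
    by move=> a b aD bD; rewrite fi.
  move=> a b aD bD fab; have := fi _ _ aD bD; rewrite fab mdistxx => /esym/eqP.
  by rewrite normr_eq0 subr_eq0 => /eqP.
move=> [a /= + fa]; rewrite in_itv/= => /(geodesic_mdist fg)[+ _].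
by rewrite fa -uv => sa; rewrite -fu sa fa.
Qed.

Lemma geodesic_point s t a : 0 <= a <= mdist s t ->
  exists2 u, mdist s u = a & mdist s u + mdist u t = mdist s t.
Proof.
move=> aD; have [f fg] := treeT.1 s t.
by have [sa at_] := geodesic_mdist fg aD; exists (f a) => //; rewrite sa at_; lra.
Qed.

(** The geodesics from [r] to [x] and to [y] agree up to a last common point
    [w] and are disjoint afterwards, so that going from [x] back to [w] and then
    on to [y] is an injective path, hence the segment from [x] to [y]. *)
Lemma branch_point r x y : exists w,
  [/\ mdist r w + mdist w x = mdist r x, mdist r w + mdist w y = mdist r y
    & mdist x w + mdist w y = mdist x y].
Proof.
have [f fg] := treeT.1 r x; have [g gg] := treeT.1 r y.
have [fi f0 fx] := fg; have [gi g0 gy] := gg.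
have X0 := mdist_ge0 r x; have Y0 := mdist_ge0 r y.
set X := mdist r x in fi fx X0 *; set Y := mdist r y in gi gy Y0 *.
pose A := [set a | [/\ 0 <= a, a <= X, a <= Y & f a = g a]].
have A0 : A 0 by split => //; rewrite f0 g0.
have supA : has_sup A.
  by split; [exists 0|exists X => a [_ aX _ _]].
pose a := sup A.
have aub b : A b -> b <= a by move=> Ab; apply: sup_ubound => //; exact: supA.2.
have a0 : 0 <= a by exact: aub.
have aX : a <= X by apply: ge_sup; [exists 0|move=> b []].
have aY : a <= Y by apply: ge_sup; [exists 0|move=> b []].
have fga : f a = g a.
  apply: mdist_eq0; apply/ler_addgt0Pr => e e0; rewrite add0r.
  have [b [b0 bX bY fgb] ab] := sup_adherent (divr_gt0 e0 (ltr0Sn _ 1)) supA.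
  have ba : b <= a by exact: aub.
  have := metric_triangle (f a) (f b) (g a).
  rewrite fi ?in_itv/= ?a0 ?b0// fgb gi ?in_itv/= ?a0 ?b0//.
  by rewrite -/a in ab; rewrite [`|b - a|]distrC (@ger0_norm _ (a - b)) => *; lra.
have neq b : a < b -> b <= X -> b <= Y -> f b <> g b.
  by move=> ab bX bY E; have := aub b; rewrite leNgt ab => /(_ _)/negP;
    apply; split => //; lra.
exists (f a).
have [ra ax] : mdist r (f a) = a /\ mdist (f a) x = X - a.
  by apply: (geodesic_mdist fg); rewrite a0.
have [_ ay] : mdist r (g a) = a /\ mdist (g a) y = Y - a.
  by apply: (geodesic_mdist gg); rewrite a0.
split; [by rewrite ra ax; lra|by rewrite ra fga ay; lra|].
have [L0|L0] := ltP 0 (X - a + (Y - a)); last first.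
  rewrite (_ : f a = x); last by apply: mdist_eq0; rewrite ax; lra.
  by rewrite mdistxx add0r.
pose f' b := f (X - b); pose g' b := g (b - (X - a) + a).
pose k b := if b <= X - a then f' b else g' b.
have kL b c : 0 <= b -> b <= c -> c <= X - a + (Y - a) ->
    mdist (k b) (k c) <= c - b.
  apply: glue_lipschitz.
  - move=> {}b {}c b0 bc cX; rewrite /f' fi ?in_itv/=; last 2 first.
      by apply/andP; split; lra.
      by apply/andP; split; lra.
    by rewrite ger0_norm; lra.
  - move=> {}b {}c b0 bc cX; rewrite /g' gi ?in_itv/=; last 2 first.
      by apply/andP; split; lra.
      by apply/andP; split; lra.
    by rewrite distrC ger0_norm; lra.
  - by rewrite /f' /g' subrr add0r subKr.
  - by apply/andP; split; lra.
have k0 : k 0 = x by rewrite /k subr_ge0 aX /f' subr0.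
have kD : k (X - a + (Y - a)) = y.
  rewrite /k; case: leP => [Ya|_]; last by rewrite /g' -gy; congr g; lra.
  have E : Y = a by lra.
  by rewrite -gy E subrr addr0 /f' subKr.
suff : segment x y (f a) by move/segment_mdist.
rewrite -k0 -kD -(arc_segment L0).
- exists (X - a); last by rewrite /k lexx /f' subKr.
  by rewrite /= in_itv/=; apply/andP; split; lra.
- move=> b c; rewrite !in_itv/= => /andP[b0 bL] /andP[c0 cL].
  have [bc|/ltW cb] := leP b c.
    by rewrite distrC ger0_norm ?subr_ge0// kL.
  by rewrite metric_sym ger0_norm ?subr_ge0// kL.
- have kr b : 0 <= b -> b <= X - a + (Y - a) ->
      mdist r (k b) = if b <= X - a then X - b else b - (X - a) + a.
    move=> b0 bL; rewrite /k; case: leP => bX.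
      by apply: (geodesic_mdist fg _).1; apply/andP; split; rewrite -/X; lra.
    by apply: (geodesic_mdist gg _).1; apply/andP; split; rewrite -/Y; lra.
  have cross b c : 0 <= b -> b <= X - a -> X - a < c -> c <= X - a + (Y - a) ->
      k b = k c -> False.
    move=> b0 bX Xc cL E.
    have kb : mdist r (k b) = X - b by rewrite kr ?bX//; lra.
    have kc : mdist r (k c) = c - (X - a) + a by rewrite kr ?leNgt ?Xc//; lra.
    have bc : X - b = c - (X - a) + a by rewrite -kb -kc E.
    move: E; rewrite /k bX leNgt Xc/= /f' /g' bc.
    by apply: neq; lra.
  move=> b c; rewrite !in_itv/= => /andP[b0 bL] /andP[c0 cL] E.
  have [bX|bX] := leP b (X - a); have [cX|cX] := leP c (X - a).
  + by have := kr _ b0 bL; have := kr _ c0 cL; rewrite E bX cX; lra.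
  + by case: (cross b c).
  + by case: (cross c b).
  + have := kr _ b0 bL; have := kr _ c0 cL; rewrite E !leNgt bX cX/=; lra.
Qed.

End RealTreeGeometry.

(** * Heights, ancestors and Gromov products *)

Section GromovProduct.
Context {R : realType} {T : metricType R} (rho : T).
Implicit Types x y z u v : T.

(** In a real tree this is the height of the branch point of [x] and [y], and
    [mdist rho u <= gromov u x] says that [u] is an ancestor of [x], that is, a
    point of the segment from the root to [x]. Being continuous in both
    arguments, it turns statements about ancestors into inequalities that pass
    to limits. *)
Definition gromov x y : R := (mdist rho x + mdist rho y - mdist x y) / 2.

Lemma gromovC x y : gromov x y = gromov y x.
Proof. by rewrite /gromov (metric_sym x); lra. Qed.

Lemma gromovxx x : gromov x x = mdist rho x.
Proof. by rewrite /gromov mdistxx; lra. Qed.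

Lemma mdist_gromov x y : mdist x y = mdist rho x + mdist rho y - 2 * gromov x y.
Proof. by rewrite /gromov; lra. Qed.

Lemma gromov_ge0 x y : 0 <= gromov x y.
Proof.
by rewrite /gromov; have := metric_triangle x rho y; rewrite (metric_sym x rho); lra.
Qed.

Lemma gromov_le x y : gromov x y <= mdist rho x.
Proof.
rewrite /gromov; have := metric_triangle rho x y; lra.
Qed.

Lemma gromov_ler x y : gromov x y <= mdist rho y.
Proof. by rewrite gromovC gromov_le. Qed.

Lemma gromov_lip x x' y : gromov x y <= gromov x' y + mdist x x'.
Proof.
rewrite /gromov; have := metric_triangle rho x' x; have := metric_triangle x' x y.
by rewrite (metric_sym x' x); lra.
Qed.

Lemma gromov_eq x y : mdist rho x <= gromov x y -> mdist rho y <= gromov x y ->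
  x = y.
Proof. by move=> xy yx; apply: mdist_eq0; rewrite mdist_gromov; lra. Qed.

Lemma mdist_below x y :
  mdist rho x <= gromov x y -> mdist x y = mdist rho y - mdist rho x.
Proof.
by move=> xy; have := gromov_le x y; rewrite (mdist_gromov x y); lra.
Qed.

End GromovProduct.

Section RootedTree.
Context {R : realType} {T : metricType R} (rho : T).
Hypothesis treeT : real_tree T.
Implicit Types x y z u v : T.
Local Notation ht := (mdist rho).
Local Notation G := (gromov rho).

Lemma segment_gromov x u : segment rho x u <-> ht u <= G u x.
Proof.
rewrite (segmentP treeT) /gromov.
have := metric_triangle rho u x; split=> *; lra.
Qed.

(** The branch points of [x] with [y] and of [y] with [z] have the same ancestor
    at height [c], the ancestor of [y] at that height; it is an ancestor of [x]
    and [z], so these two branch at height at least [c]. *)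
Lemma gromov_four_point y x z c : c <= G x y -> c <= G y z -> c <= G x z.
Proof.
move=> xy yz; have [c0|c0] := ltP c 0.
  by rewrite (le_trans (ltW c0))// gromov_ge0.
have [w [wx wy wxy]] := branch_point treeT rho x y.
have [w' [wy' wz' wyz']] := branch_point treeT rho y z.
have Gw : G x y = ht w by rewrite /gromov (metric_sym x w) in wxy *; lra.
have Gw' : G y z = ht w' by rewrite /gromov (metric_sym y w') in wyz' *; lra.
have [|u uc uw] := @geodesic_point _ _ treeT rho w c; first by rewrite c0 -Gw.
have [|u' uc' uw'] := @geodesic_point _ _ treeT rho w' c.
  by rewrite c0 -Gw'.
have up (p q r : T) : ht p + mdist p q = ht q -> ht q + mdist q r = ht r ->
    ht p + mdist p r = ht r.
  move=> pq qr; have := metric_triangle rho p r; have := metric_triangle p q r.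
  by lra.
have ux := up _ _ _ uw wx; have uy := up _ _ _ uw wy.
have uy' := up _ _ _ uw' wy'; have uz := up _ _ _ uw' wz'.
have E : u = u' by apply: (segment_inj treeT uy uy'); rewrite uc uc'.
rewrite -E in uz; have := metric_triangle x u z.
by rewrite /gromov (metric_sym x u); lra.
Qed.

Definition ancestor x c : T := xget rho [set u | ht u = c /\ c <= G u x].

Lemma ancestorP x c : 0 <= c <= ht x ->
  ht (ancestor x c) = c /\ c <= G (ancestor x c) x.
Proof.
move=> cx; rewrite /ancestor; case: xgetP => [u _ []//|/= no].
have [u uc ux] := geodesic_point treeT cx.
by case: (no u); split => //; rewrite /gromov; lra.
Qed.

End RootedTree.

(** * Monotone limits and the order *)

Section DirectedLimits.
Context {R : realType} {T : metricType R} (rho : T).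
Hypothesis compT : compact [set: T].
Local Notation G := (gromov rho).
Context {I : Type} (r : I -> I -> Prop) (q : I -> T).
Hypothesis r_refl : forall i, r i i.
Hypothesis r_trans : forall i j k, r i j -> r j k -> r i k.
Hypothesis r_total : forall i j, r i j \/ r j i.
Hypothesis q_between : forall i j k, r i j -> r j k -> G (q i) (q k) <= G (q i) (q j).

Definition converges_along (D : set I) (x : T) :=
  forall e, 0 < e -> exists2 i0, D i0 &
    forall i, D i -> r i0 i -> mdist (q i) x < e.

Lemma frequently_cluster (D P : set I) : D !=set0 ->
  (forall i0, D i0 -> exists i, [/\ D i, r i0 i & P i]) ->
  exists x, forall e i0, 0 < e -> D i0 ->
    exists i, [/\ D i, r i0 i, P i & mdist (q i) x < e].
Proof.
move=> [d Dd] freq.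
pose B i0 := q @` [set i | [/\ D i, r i0 i & P i]].
have FF : ProperFilter (filter_from D B).
  apply: filter_from_proper; last first.
    by move=> i0 /freq[i Pi]; exists (q i), i.
  apply: filter_from_filter; first by exists d.
  move=> i j Di Dj; case: (r_total i j) => ij; [exists j|exists i] => //.
    by move=> _ [k [Dk jk Pk] <-]; split; exists k => //; split => //;
      exact: r_trans jk.
  by move=> _ [k [Dk jk Pk] <-]; split; exists k => //; split => //;
    exact: r_trans jk.
have [|x [_ Fx]] := compT FF; first by exists d.
exists x => e i0 e0 Di0.
have [||_ [[i [Di i0i Pi] <-] xi]] := Fx (B i0) (ball x e).
- by exists i0.
- exact: nbhsx_ballx.
by exists i; split => //; move: xi; rewrite ballEmdist/= metric_sym.
Qed.

(** By compactness it suffices to compare two cluster points [x] and [y].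
    Moving along the order from near [x] to near [y] and back to near [x], the
    betweenness of [q] puts [x] below [y]; by symmetry [x = y]. Taking for [q]
    the identity of the tree gives limits of increasing families of points, and
    taking an exploration in reversed time gives its right limits. *)
Lemma directed_limit (D : set I) : D !=set0 -> exists x, converges_along D x.
Proof.
move=> D0; have [d Dd] := D0.
have [|x xc] := @frequently_cluster D setT D0; first by move=> i Di; exists i.
exists x => e e0; apply: contrapT => nex.
have [|y yc] := @frequently_cluster D [set i | e <= mdist (q i) x] D0.
  move=> i0 Di0; apply: contrapT => no; apply: nex; exists i0 => // i Di i0i.
  by rewrite ltNge; apply/negP => ei; apply: no; exists i.
have xyc e' i0 : 0 < e' -> D i0 -> exists i, [/\ D i, r i0 i & mdist (q i) x < e'].
  by move=> e'0 /(xc _ _ e'0)[i []]; exists i.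
have yyc e' i0 : 0 < e' -> D i0 -> exists i, [/\ D i, r i0 i & mdist (q i) y < e'].
  by move=> e'0 /(yc _ _ e'0)[i []]; exists i.
have half (x' y' : T) :
  (forall e' i0, 0 < e' -> D i0 -> exists i, [/\ D i, r i0 i & mdist (q i) x' < e']) ->
  (forall e' i0, 0 < e' -> D i0 -> exists i, [/\ D i, r i0 i & mdist (q i) y' < e']) ->
  mdist rho x' <= G x' y'.
  move=> x'c y'c; apply/ler_addgt0Pr => e' e'0.
  have e4 : 0 < e' / 4 by lra.
  have [i [Di _ xi]] := x'c _ _ e4 Dd; have [j [Dj ij yj]] := y'c _ _ e4 Di.
  have [k [Dk jk xk]] := x'c _ _ e4 Dj.
  have := q_between ij jk.
  have := gromov_lip rho x' (q i) x'; have := gromov_lip rho x' (q k) (q i).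
  have := gromov_lip rho (q i) x' (q j); have := gromov_lip rho (q j) y' x'.
  rewrite (gromovC _ x' (q i)) (gromovC _ (q k)) (gromovC _ x' (q j)) (gromovC _ y').
  by rewrite gromovxx (metric_sym x' (q i)) (metric_sym x' (q k)); lra.
have xy : x = y.
  by apply: (@gromov_eq _ _ rho); [|rewrite gromovC]; exact: half.
have [i [_ _ ex]] := yc _ _ e0 Dd.
by rewrite -xy ltNge ex.
Qed.

End DirectedLimits.

Section OrderedTree.
Context {R : realType} {T : metricType R} (rho : T) (le : rel T).
Hypothesis treeT : real_tree T.
Hypothesis linle : linear_order le.
Hypothesis or1 : Or1 rho le.
Hypothesis or2 : Or2 rho le.
Implicit Types x y z u v s : T.
Local Notation ht := (mdist rho).
Local Notation G := (gromov rho).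

Lemma below_le u x : ht u <= G u x -> le u x.
Proof. by move=> /(segment_gromov _ treeT) /or1. Qed.

(** The point [g] of Or2 is the higher of the branch points of [s1] with [s2]
    and with [s3]; Or2 puts it below [s2]. The inequality says that an ancestor
    common to [s1] and [s3] is an ancestor of every point between them. *)
Lemma order_gromov s1 s2 s3 : le s1 s2 -> le s2 s3 -> G s1 s3 <= G s1 s2.
Proof.
move=> s12 s23; pose c := Num.max (G s1 s2) (G s1 s3).
have c2 : G s1 s2 <= c by rewrite le_max lexx.
have c3 : G s1 s3 <= c by rewrite le_max lexx orbT.
have c0 : 0 <= c by rewrite (le_trans _ c2)// gromov_ge0.
have cs1 : c <= ht s1 by rewrite ge_max !gromov_le.
have [|gc g1] := @ancestorP _ _ rho treeT s1 c; first by rewrite c0.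
set g := ancestor rho s1 c in gc g1.
suff /(or2 s12 s23)/(segment_gromov _ treeT) g2 :
    segment rho g = segment rho s1 `&` (segment rho s2 `|` segment rho s3).
  rewrite (le_trans c3)//; apply: (gromov_four_point treeT (y := g)).
    by rewrite gromovC.
  by rewrite -gc.
apply/seteqP; split => x.
  move=> /(segment_gromov _ treeT) xg.
  have xc : ht x <= c by rewrite -gc (le_trans xg)// gromov_ler.
  have x1 := gromov_four_point treeT xg (le_trans xc g1).
  split; first exact/(segment_gromov _ treeT).
  have [E|E] : c = G s1 s2 \/ c = G s1 s3.
      by rewrite /c; case: leP; [right|left].
    left; apply/(segment_gromov _ treeT).
    by apply: (gromov_four_point treeT x1); rewrite -E.
  right; apply/(segment_gromov _ treeT).
  by apply: (gromov_four_point treeT x1); rewrite -E.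
move=> [/(segment_gromov _ treeT) x1 x23]; apply/(segment_gromov _ treeT).
suff xc : ht x <= c.
  by apply: (gromov_four_point treeT x1); rewrite gromovC (le_trans xc).
by case: x23 => /(segment_gromov _ treeT) x2; [apply: le_trans c2|apply: le_trans c3];
  apply: (gromov_four_point treeT _ x2); rewrite gromovC.
Qed.

Lemma order_gromov_r s1 s2 s3 : le s1 s2 -> le s2 s3 -> G s1 s3 <= G s2 s3.
Proof.
move=> s12 s23; apply: (gromov_four_point treeT _ (lexx _)).
by rewrite (gromovC _ s2) order_gromov.
Qed.

Lemma strictP s t : strict le s t = ~~ le t s.
Proof.
case: linle => refl anti trans tot; rewrite /strict.
apply/andP/idP => [[st sle]|nts].
  by apply: contra st => ts; apply/eqP/anti; rewrite sle.
by split; [apply: contra nts => /eqP ->|have := tot s t; rewrite (negbTE nts) orbF].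
Qed.

Lemma root_le s : le rho s.
Proof. by apply: below_le; rewrite mdistxx gromov_ge0. Qed.

(** If [u] preceded [v], betweenness would make [u] an ancestor of [v]. Hence
    the ancestors of [s] are cofinal among the points strictly before [s]. *)
Lemma strict_ancestor s v u : strict le v s ->
  G v s < ht u -> ht u < ht s -> ht u <= G u s -> strict le v u /\ strict le u s.
Proof.
move=> vs qv qs us; have us' := below_le us; rewrite !strictP; split.
  apply/negP => uv; have := order_gromov_r uv; move: vs; rewrite strictP => vs.
  case: linle => _ _ _ tot; have := tot s v; rewrite (negbTE vs)/= => vs' /(_ _ vs').
  by rewrite leNgt (lt_le_trans qv us).
apply/negP => su; case: linle => _ anti _ _.
have E : u = s by apply: anti; rewrite us'.
by move: qs; rewrite E ltxx.
Qed.

Lemma strict_gromov_lt s v : strict le v s -> G v s < ht s.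
Proof.
rewrite strictP ltNge => nsv; apply: contra nsv => sv.
by apply: below_le; rewrite gromovC.
Qed.

End OrderedTree.

(** * The exploration of the tree *)

Section Exploration.
Context {R : realType} {T : metricType R} (rho : T) (le : rel T).
Context (mu : {finite_measure set (borel rho) -> \bar R}).
Hypothesis treeT : real_tree T.
Hypothesis compT : compact [set: T].
Hypothesis linle : linear_order le.
Hypothesis or1 : Or1 rho le.
Hypothesis or2 : Or2 rho le.
Hypothesis mes : Mes le mu.
Implicit Types (x y z u v s : T) (t r e c : R).
Local Notation ht := (mdist rho).
Local Notation G := (gromov rho).

Let le_refl s : le s s. Proof. by case: linle. Qed.
Let le_tr u v s : le u v -> le v s -> le u s.
Proof. by case: linle => _ _ + _; apply. Qed.
Let le_tot u v : le u v \/ le v u.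
Proof. by apply/orP; case: linle => _ _ _; apply. Qed.

Lemma open_borel (A : set T) : open A -> measurable (A : set (borel rho)).
Proof. exact: sub_sigma_algebra. Qed.

Lemma set1_borel x : measurable ([set x] : set (borel rho)).
Proof.
rewrite -[X in measurable X]setCK; apply: measurableC; apply: open_borel.
apply: open_ballP => y /= yx; exists (mdist y x).
  by rewrite mdist_gt0; exact/eqP.
by move=> z yz zx; rewrite zx ltxx in yz.
Qed.

(** A point close to [v] still has an ancestor in common with [v] that is not an
    ancestor of [s], so betweenness keeps it on the same side of [s] as [v]. *)
Lemma open_after s : open [set v | strict le s v].
Proof.
apply: open_ballP => v /= sv.
exists (ht v - G v s).
  rewrite subr_gt0 ltNge; apply: contraTN sv => vs.
  by rewrite strictP// negbK; exact: (below_le treeT or1).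
move=> y vy; rewrite strictP//; apply/negP => ys.
have sv' : le s v by case/andP: sv.
have := order_gromov_r treeT or2 ys sv'; have := gromov_lip rho v y v.
by rewrite gromovxx; move: vy; rewrite (gromovC _ v s); lra.
Qed.

Lemma after_borel s : measurable ([set v | strict le s v] : set (borel rho)).
Proof. by apply: open_borel; exact: open_after. Qed.

Lemma before_borel s : measurable ([set v | strict le v s] : set (borel rho)).
Proof.
rewrite (_ : [set _ | _] = ~` ([set v | strict le s v] `|` [set s])).
  by apply: measurableC; apply: measurableU; [exact: after_borel|exact: set1_borel].
apply/seteqP; split=> v /=.
  rewrite strictP// => sv [|vs].
    by rewrite strictP//; case: (le_tot v s) => [->|vs]; rewrite // vs in sv.
  by move: sv; rewrite vs le_refl.
move=> nv; rewrite strictP//; apply/negP => sv; apply: nv.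
by rewrite /strict; case: (eqVneq s v) => [->|sv']; [right|left; apply/andP].
Qed.

Lemma above_borel u : measurable ([set x | ht u <= G u x] : set (borel rho)).
Proof.
rewrite -[X in measurable X]setCK; apply: measurableC; apply: open_borel.
apply: open_ballP => x /= /negP; rewrite -ltNge => xu.
exists (ht u - G u x); first by rewrite subr_gt0.
move=> y xy; apply/negP; rewrite -ltNge.
by have := gromov_lip rho y x u; rewrite !(gromovC _ _ u) (metric_sym y); lra.
Qed.

(** [mass_before s] is the time at which [s] is first visited: the exploration
    spends time [mu A] in a set [A] and visits points in increasing order. *)
Definition mass_before s : R := fine (mu [set v | strict le v s]).
Local Notation phi := mass_before.
Definition total_mass : R := fine (mu [set: T]).
Local Notation M := total_mass.

Lemma mass_beforeE s : (phi s)%:E = mu [set v | strict le v s].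
Proof. by rewrite fineK//; apply: fin_num_measure; exact: before_borel. Qed.

Lemma total_massE : M%:E = mu [set: T].
Proof. by rewrite fineK//; apply: fin_num_measure; exact: measurableT. Qed.

Lemma total_mass_ge0 : 0 <= M.
Proof. exact: fine_ge0. Qed.

Lemma mass_before_ge0 s : 0 <= phi s.
Proof. exact: fine_ge0. Qed.

Lemma mass_before_le_total s : phi s <= M.
Proof.
rewrite -lee_fin mass_beforeE total_massE; apply: le_measure => //.
- by rewrite inE; exact: before_borel.
- by rewrite inE; exact: measurableT.
Qed.

Lemma mass_before_root : phi rho = 0.
Proof.
rewrite /mass_before (_ : [set _ | _] = set0) ?measure0//.
by apply/seteqP; split=> // v /=; rewrite strictP// (root_le treeT or1).
Qed.

(** This strict monotonicity is what (Mes) is for: it makes the points of the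
    tree recoverable from their first visit times. *)
Lemma mass_before_lt u v : strict le u v -> phi u < phi v.
Proof.
move=> uv; have := mes uv; set B := [set s | _] => B0.
have mB : measurable (B : set (borel rho)).
  by apply: measurableI; [exact: after_borel|exact: before_borel].
rewrite -lte_fin !mass_beforeE.
apply: (@lt_le_trans _ _ (mu [set w | strict le w u] + mu B)%E).
  by rewrite lteDl//; apply: fin_num_measure; exact: before_borel.
rewrite -measureU//; last 2 first.
- exact: before_borel.
- apply/seteqP; split => // w [/= wu [uw _]].
  by move: uw wu; rewrite (strictP linle) /strict => /negbTE ->; rewrite andbF.
apply: le_measure; rewrite ?inE.
- by apply: measurableU => //; exact: before_borel.
- exact: before_borel.
move=> w /= [wu|[_ ->//]]; rewrite strictP//; apply/negP => vw.
move: wu uv; rewrite !strictP// => nuw; case/negP.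
by have [/(le_tr vw)//|uw] := le_tot w u; rewrite uw in nuw.
Qed.

Lemma mass_before_le u v : (phi u <= phi v) = le u v.
Proof.
apply/idP/idP => [|uv]; first by apply: contraTT; rewrite -strictP// -ltNge;
  exact: mass_before_lt.
have [->//|nuv] := eqVneq u v.
by apply: ltW; apply: mass_before_lt; rewrite /strict nuv.
Qed.

(** The points strictly before [s] are the points before some proper ancestor
    of [s], so [mass_before] is left-continuous along branches. *)
Lemma mass_before_sup s c : 0 <= c -> c < phi s ->
  exists u, [/\ ht u < ht s, ht u <= G u s & c < phi u].
Proof.
move=> c0 cs; apply: contrapT => no.
have hs : 0 < ht s.
  rewrite mdist_gt0; apply: contraTneq cs => <-.
  by rewrite mass_before_root -leNgt.
pose q n := ht s - ht s / n.+1%:R.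
pose u n := ancestor rho s (q n).
have q0 n : 0 <= q n.
  have n1 : 1 <= n.+1%:R :> R by rewrite ler1n.
  by rewrite /q subr_ge0 ler_pdivrMr ?ltr0Sn// ler_peMr// ltW.
have qs n : q n < ht s by rewrite /q ltrBlDr ltrDl divr_gt0.
have uP n : ht (u n) = q n /\ q n <= G (u n) s.
  by apply: ancestorP; rewrite // q0 ltW.
pose A n := [set v | strict le v (u n)].
have ule m n : (m <= n)%N -> le (u m) (u n).
  move=> mn; apply: (below_le treeT or1); have [um ms] := uP m; have [un ns] := uP n.
  have qmn : q m <= q n.
    rewrite lerD2l lerN2 ler_wpM2l ?(ltW hs)// lef_pV2 ?posrE//.
    by rewrite ler_nat ltnS.
  rewrite um; apply: (gromov_four_point treeT ms).
  by rewrite gromovC (le_trans qmn).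
have mA n : measurable (A n : set (borel rho)) by exact: before_borel.
have strict_le w x y : strict le w x -> le x y -> strict le w y.
  rewrite !strictP// => nxw xy; apply: contra nxw => yw; exact: le_tr yw.
have cupA : \bigcup_n A n = [set v | strict le v s].
  apply/seteqP; split=> [v [n _ vn]|v /= vs].
    by apply: strict_le vn _; apply: (below_le treeT or1); have [-> ] := uP n.
  have Gv := strict_gromov_lt treeT linle or1 vs.
  have [n nP] : exists n, ht s / n.+1%:R < ht s - G v s.
    have d0 : 0 < (ht s - G v s) / ht s by rewrite divr_gt0// subr_gt0.
    have [n _ nP] := near_infty_natSinv_lt (PosNum d0).
    exists n; have := nP n (leqnn n) => /=.
    by rewrite ltr_pdivlMr// mulrC.
  exists n => //; have [un ns] := uP n.
  apply: (strict_ancestor treeT linle or1 or2 vs _ _ _).1; rewrite ?un//.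
  by rewrite /q; set a := ht s / _ in nP *; lra.
have : (mu \o A) n @[n --> \oo] --> mu (\bigcup_n A n).
  apply: nondecreasing_cvg_mu => //; first exact: bigcup_measurable.
  move=> m n mn; apply/subsetPset => v; rewrite /A /=.
  by move=> vm; apply: strict_le vm (ule _ _ mn).
rewrite cupA -mass_beforeE => cvgA.
have := cvg_lim (@ereal_hausdorff R) cvgA => limA.
have : (limn (mu \o A) <= c%:E)%E.
  apply: lime_le; first by apply/cvg_ex; exists (phi s)%:E.
  apply: nearW => n /=; rewrite -mass_beforeE lee_fin leNgt; apply/negP => cn.
  by apply: no; exists (u n); have [-> ] := uP n; split.
by rewrite limA lee_fin leNgt cs.
Qed.

(** Truncating at 0 lets the root be visited at negative times too, so that the
    position is defined, and left-continuous, on the whole real line. *)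
Definition visited t : set T := [set s | phi s <= Num.max 0 t].

Lemma visited_root t : visited t rho.
Proof. by rewrite /visited /= mass_before_root le_max lexx. Qed.

Lemma visited_mono t t' : t <= t' -> visited t `<=` visited t'.
Proof.
by move=> tt s /le_trans; apply; rewrite ge_max !le_max lexx /= tt orbT.
Qed.

Definition position t : T :=
  xget rho [set x | converges_along le id (visited t) x].
Local Notation p := position.

Lemma position_cvg t : converges_along le id (visited t) (p t).
Proof.
rewrite /position; case: xgetP => [x _ //|/= no].
have [|x xl] := @directed_limit _ _ rho compT _ le id le_refl
  (fun i j k => @le_tr i j k) le_tot (order_gromov treeT or2) (visited t).
  by exists rho; exact: visited_root.
by case: (no x).
Qed.

Lemma position_near t v e : 0 < e -> visited t v ->
  exists s, [/\ visited t s, le v s & mdist s (p t) < e].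
Proof.
move=> e0 tv; have [s0 ts0 s0e] := position_cvg t e0.
have [s0v|vs0] := le_tot s0 v; first by exists v; split => //; exact: s0e.
by exists s0; split => //; exact: s0e.
Qed.

Lemma position_max t x : visited t x ->
  (forall s, visited t s -> le s x) -> p t = x.
Proof.
move=> tx maxx; apply/mdist_eq0/ler_addgt0Pr => e e0; rewrite add0r metric_sym.
have [v [tv xv ve]] := position_near e0 tx.
have E : x = v by case: linle => _ anti _ _; apply: anti; rewrite xv maxx.
by rewrite -E in ve; exact: ltW.
Qed.

Lemma position_mass_before s : p (phi s) = s.
Proof.
apply: position_max; rewrite /visited /= max_r ?mass_before_ge0//.
by move=> v; rewrite mass_before_le.
Qed.

Lemma position_between (r s t : R) : r <= s -> s <= t -> G (p r) (p t) <= G (p r) (p s).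
Proof.
move=> rs st; apply/ler_addgt0Pr => e e0; have e4 : 0 < e / 4 by lra.
have [x [xr _ xe]] := position_near e4 (visited_root r).
have [y [ys xy ye]] := position_near e4 (visited_mono rs xr).
have [z [zt yz ze]] := position_near e4 (visited_mono st ys).
have := order_gromov treeT or2 xy yz.
have := gromov_lip rho (p r) x (p t); have := gromov_lip rho (p t) z x.
have := gromov_lip rho x (p r) y; have := gromov_lip rho y (p s) (p r).
rewrite (gromovC _ (p t) x) (gromovC _ z) (gromovC _ y) (gromovC _ (p s)).
rewrite (metric_sym (p r)) (metric_sym (p t)) => *; lra.
Qed.

(** Otherwise a proper ancestor of [p t] would be first visited after [t], though
    it is an ancestor of visited points close to [p t]. *)
Lemma mass_before_position t : phi (p t) <= Num.max 0 t.
Proof.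
rewrite leNgt; apply/negP => tp.
have [|u [up uG tu]] := mass_before_sup _ tp; first by rewrite le_max lexx.
have d0 : 0 < ht (p t) - ht u by rewrite subr_gt0.
have [s [st _ sd]] := position_near d0 (visited_root t).
have : le u s.
  apply: (below_le treeT or1); apply: (gromov_four_point treeT uG).
  have := gromov_lip rho (p t) s (p t).
  by rewrite gromovxx (gromovC _ s) (metric_sym (p t)); lra.
by rewrite -mass_before_le leNgt (le_lt_trans st tu).
Qed.

(** When [t] is the first visit time of a point [s], the limit of the points
    strictly before [s] is [s] itself, because the ancestors of [s] are cofinal
    among them. *)
Lemma position_tail t e : 0 < t -> 0 < e -> exists2 v, phi v < t &
  forall s, phi s <= t -> le v s -> mdist s (p t) < e.
Proof.
move=> t0 e0; have maxt : Num.max 0 t = t by rewrite max_r ?ltW.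
have [s0 s0t s0e] := position_cvg t e0.
rewrite /visited /= maxt in s0t s0e.
have [lt0|s0t'] := ltP (phi s0) t; first by exists s0 => // s st; exact: s0e.
have ts : t = phi s0 by apply/le_anti; rewrite s0t s0t'.
have s0rho : rho != s0.
  by apply: contraTneq t0 => E; rewrite ts -E mass_before_root ltxx.
have [|x xl] := @directed_limit _ _ rho compT _ le id le_refl
  (fun i j k => @le_tr i j k) le_tot (order_gromov treeT or2)
  [set v | strict le v s0].
  by exists rho; rewrite /= /strict s0rho (root_le treeT or1).
have xs0 : x = s0.
  apply: mdist_eq0; apply/ler_addgt0Pr => d d0; rewrite add0r.
  have d2 : 0 < d / 2 by lra.
  have [v vs vd] := xl _ d2.
  have Gv := strict_gromov_lt treeT linle or1 vs.
  pose c := Num.max (Num.max 0 (ht s0 - d / 2)) ((G v s0 + ht s0) / 2).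
  have cs : c < ht s0.
    by rewrite !gt_max mdist_gt0 s0rho/=; apply/andP; split; lra.
  have [|uc us] := @ancestorP _ _ rho treeT s0 c; first by rewrite !le_max lexx/= ltW.
  set u := ancestor rho s0 c in uc us.
  have Gc : G v s0 < c by rewrite lt_max; apply/orP; right; lra.
  have dc : ht s0 - d / 2 <= c by rewrite !le_max lexx orbT.
  have [vu us'] : strict le v u /\ strict le u s0.
    by apply: (strict_ancestor treeT linle or1 or2 vs); rewrite uc.
  have := vd _ us' (proj2 (andP vu)).
  have := mdist_below (x := u) (y := s0) (rho := rho); rewrite uc => /(_ us) E.
  by have := metric_triangle x u s0; rewrite E (metric_sym x u); lra.
have [v vs ve] := xl _ e0; rewrite xs0 in ve.
exists v; first by rewrite ts; exact: mass_before_lt.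
move=> s; rewrite ts position_mass_before mass_before_le => ss0 vs'.
have [->|ns] := eqVneq s s0; first by rewrite mdistxx.
by apply: ve => //; rewrite /= /strict ns.
Qed.

(** The visited points close to [p t] are reached strictly before [t]. *)
Lemma position_left t e : 0 < e ->
  exists2 r0, r0 < t & forall r, r0 < r -> r <= t -> mdist (p r) (p t) < e.
Proof.
move=> e0; have [t0|t0] := ltP 0 t; last first.
  exists (t - 1); first lra.
  by move=> r _ rt; rewrite /position /visited !max_l ?mdistxx// (le_trans rt).
have e2 : 0 < e / 2 by lra.
have [v vt ve] := position_tail t0 e2.
exists (phi v) => // r vr rt; have r0 := le_lt_trans (mass_before_ge0 v) vr.
have [|s [sr vs se]] := @position_near r v _ e2.
  by rewrite /visited /= le_max (ltW vr) orbT.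
have := ve s; rewrite /visited /= max_r ?(ltW r0)// in sr.
move=> /(_ (le_trans sr rt) vs) => se'.
by have := metric_triangle (p r) s (p t); rewrite (metric_sym (p r) s); lra.
Qed.

(** The point [y] is the right limit of the position at [t]. If the branch of [y]
    left the branch of [p t], the points at which it does so would be first
    visited before every time after [t], hence by time [t], and betweenness would
    make them ancestors of [p t]. So the height can only jump downwards. *)
Lemma position_right t : 0 <= t ->
  exists2 y, (forall e, 0 < e -> exists2 r0, t < r0 &
    forall r, t < r -> r <= r0 -> mdist (p r) y < e) & ht y <= G y (p t).
Proof.
move=> t0.
have [|||||y yl] := @directed_limit _ _ rho compT R (fun i j => j <= i) p _ _ _ _
  [set r | t < r].
- by move=> i.
- by move=> i j k ji kj; exact: le_trans ji.
- by move=> i j; apply/orP; rewrite orbC; exact: le_total.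
- move=> i j k ji kj; have := position_between kj ji.
  rewrite (gromovC _ (p i) (p k)) (gromovC _ (p i) (p j)) => H.
  by apply: (gromov_four_point treeT _ (lexx _)); rewrite (gromovC _ (p j)).
- by exists (t + 1) => /=; lra.
have yr : forall e, 0 < e -> exists2 r0, t < r0 &
    forall r, t < r -> r <= r0 -> mdist (p r) y < e.
  by move=> e e0; have [r0 tr0 H] := yl _ e0; exists r0 => // r tr rr0; exact: H.
exists y => //; rewrite leNgt; apply/negP => yp.
pose c := (G y (p t) + ht y) / 2.
have c0 := gromov_ge0 rho y (p t).
have [|uc uy] := @ancestorP _ _ rho treeT y c; first by apply/andP; split; rewrite /c; lra.
set u := ancestor rho y c in uc uy.
have d0 : 0 < ht y - c by rewrite /c; lra.
have [r0 tr0 Hr] := yr _ d0.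
have up r : t < r -> r <= r0 -> c <= G u (p r).
  move=> tr rr0; apply: (gromov_four_point treeT uy).
  have := Hr r tr rr0; have := gromov_lip rho y (p r) y.
  by rewrite gromovxx (gromovC _ (p r)) (metric_sym y); lra.
have ut : phi u <= t.
  apply/ler_addgt0Pr => e e0; pose r := Num.min (t + e) r0.
  have tr : t < r by rewrite lt_min tr0 ltrDl e0.
  have rr0 : r <= r0 by rewrite ge_min lexx orbT.
  apply: (@le_trans _ _ r); last by rewrite ge_min lexx.
  apply: (@le_trans _ _ (phi (p r))).
    by rewrite mass_before_le; apply: (below_le treeT or1); rewrite uc; exact: up.
  by have := mass_before_position r; rewrite max_r// (le_trans t0)// ltW.
have := position_between ut (ltW tr0); rewrite position_mass_before => H.
have cp := le_trans (up _ tr0 (lexx _)) H.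
have := gromov_four_point treeT _ cp; move=> /(_ y); rewrite gromovC => /(_ uy).
by rewrite /c; lra.
Qed.

(** The branch point [w] of [p s] and [p t] is approached, from above on the
    branch of [p t], by points first visited between the times [s] and [t]. *)
Lemma position_inf (s t e : R) : 0 <= s -> s <= t -> 0 < e ->
  exists r, [/\ s <= r, r <= t & ht (p r) < G (p s) (p t) + e].
Proof.
move=> s0 st e0; set c := G (p s) (p t).
have [pc|cp] := leP (ht (p t)) c; first by exists t; split => //; lra.
pose d := Num.min ((c + ht (p t)) / 2) (c + e / 2).
have cd : c < d by rewrite lt_min; apply/andP; split; lra.
have de : d <= c + e / 2 by rewrite ge_min lexx orbT.
have dt : d <= (c + ht (p t)) / 2 by rewrite ge_min lexx.
have c0 : 0 <= c by exact: gromov_ge0.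
have [|ud up] := @ancestorP _ _ rho treeT (p t) d; first by apply/andP; split; lra.
set u := ancestor rho (p t) d in ud up.
have ut : phi u <= t.
  apply: (@le_trans _ _ (phi (p t))).
    by rewrite mass_before_le; apply: (below_le treeT or1); rewrite ud.
  by have := mass_before_position t; rewrite max_r// (le_trans s0).
exists (phi u); split => //; last by rewrite position_mass_before ud; lra.
rewrite leNgt; apply/negP => us.
have := position_between (ltW us) st; rewrite position_mass_before => H.
have := gromov_four_point treeT _ up; move=> /(_ (p s)).
by rewrite gromovC (le_trans up)// -/c leNgt cd => /(_ isT).
Qed.

End Exploration.

(** * The height function coding the tree *)

Section CodingFunction.
Context {R : realType} {T : metricType R} (rho : T) (le : rel T).
Context (mu : {finite_measure set (borel rho) -> \bar R}).
Hypothesis treeT : real_tree T.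
Hypothesis compT : compact [set: T].
Hypothesis linle : linear_order le.
Hypothesis or1 : Or1 rho le.
Hypothesis or2 : Or2 rho le.
Hypothesis mes : Mes le mu.
Implicit Types (x y z u v : T) (s t r e c : R).
Local Notation ht := (mdist rho).
Local Notation G := (gromov rho).
Local Notation phi := (mass_before le mu).
Local Notation M := (total_mass mu).
Local Notation p := (position le mu).

Definition coding_fun t : R := if t \in `[0, M] then ht (p t) else 0.

Lemma coding_funE t : 0 <= t <= M -> coding_fun t = ht (p t).
Proof. by rewrite /coding_fun in_itv/= => ->. Qed.

Lemma coding_fun_left t : 0 < t <= M ->
  coding_fun x @[x --> t^'-] --> coding_fun t.
Proof.
move=> /andP[t0 tM]; apply/cvgrPdist_lt => e e0.
have [r0 r0t r0e] := position_left treeT compT linle or1 or2 mes t e0.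
near=> r; rewrite !coding_funE ?(ltW t0)//; last first.
  apply/andP; split; first by apply: ltW; near: r; exact: nbhs_left_gt.
  by apply: le_trans tM; near: r; exact: nbhs_left_le.
apply: le_lt_trans (mdist_lip rho _ _) _; rewrite metric_sym.
by apply: r0e; [near: r; exact: nbhs_left_gt|near: r; exact: nbhs_left_le].
Unshelve. all: by end_near. Qed.

Lemma coding_fun_right t : 0 <= t < M ->
  exists2 l, coding_fun x @[x --> t^'+] --> l & 0 <= l <= coding_fun t.
Proof.
move=> /andP[t0 tM].
have [y yr yp] := position_right treeT compT linle or1 or2 mes t0.
exists (ht y); last first.
  by rewrite mdist_ge0 coding_funE ?t0 ?(ltW tM)//= (le_trans yp)// gromov_ler.
apply/cvgrPdist_lt => e e0; have [r0 tr0 r0e] := yr _ e0.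
near=> r; rewrite coding_funE; last first.
  apply/andP; split; last by near: r; exact: nbhs_right_le.
  by apply: (le_trans t0); near: r; exact: nbhs_right_ge.
apply: le_lt_trans (mdist_lip rho _ _) _; rewrite metric_sym.
by apply: r0e; near: r; [exact: nbhs_right_gt|exact: nbhs_right_le].
Unshelve. all: by end_near. Qed.

Lemma position0 : p 0 = rho.
Proof. by rewrite -{1}(mass_before_root mu treeT linle or1) position_mass_before. Qed.

Lemma coding_fun0 : coding_fun 0 = 0.
Proof. by rewrite coding_funE ?lexx ?total_mass_ge0// position0 mdistxx. Qed.

Definition coding_height : height R.
Proof.
refine (@Height R M coding_fun (total_mass_ge0 mu) _ _ coding_fun_left _ coding_fun0 _ _).
- by move=> t; rewrite /coding_fun => /negbTE ->.
- by move=> t; rewrite /coding_fun => ->; exact: mdist_ge0.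
- by move=> t /coding_fun_right[l /cvgP].
- move=> M0; have [|l + l0] := @coding_fun_right 0; first by rewrite lexx.
  by rewrite coding_fun0 in l0; rewrite (le_anti l0).
- move=> t /coding_fun_right[l /cvg_lim -> //] /andP[_ lt].
  by rewrite subr_ge0.
Defined.
Local Notation h := coding_height.

Lemma m_h_coding s t : 0 <= s -> s <= t -> t <= M -> m_h h s t = G (p s) (p t).
Proof.
move=> s0 st tM; have inM r : s <= r <= t -> 0 <= r <= M by lra.
apply/le_anti/andP; split.
  apply/ler_addgt0Pr => e e0.
  have [r [sr rt /ltW re]] := position_inf treeT compT linle or1 or2 mes s0 st e0.
  apply: le_trans re; rewrite -coding_funE; last by apply: inM; rewrite sr.
  by apply: (@m_h_le _ h); rewrite min_l// max_r// sr.
apply: le_m_h => r; rewrite min_l// max_r// => rst; have /andP[sr rt] := rst.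
rewrite /= coding_funE; last exact: inM.
by rewrite (le_trans (position_between mu treeT compT linle or1 or2 sr rt))// gromov_ler.
Qed.

Lemma d_h_coding s t : 0 <= s <= M -> 0 <= t <= M -> d_h h s t = mdist (p s) (p t).
Proof.
wlog st : s t / s <= t.
  by move=> H sM tM; have [/H->//|/ltW ts] := leP s t; rewrite d_hC metric_sym H.
move=> sM tM; rewrite /d_h /= !coding_funE// m_h_coding//; try lra.
by rewrite (mdist_gromov rho (p s)).
Qed.

Lemma visit_subproof x : phi x \in `[0, zeta h].
Proof. by rewrite in_itv/= mass_before_ge0 mass_before_le_total. Qed.

Definition visit x : dom h := exist _ (phi x) (visit_subproof x).

Definition coding_map x : T_h h := p_h (visit x).
Local Notation f := coding_map.

Lemma dom_itv (t : dom h) : 0 <= val t <= M.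
Proof. by case: t => t /=; rewrite in_itv. Qed.

Lemma coding_map_dist x y : mdist (f x) (f y) = mdist x y.
Proof.
rewrite [LHS]dist_hE d_h_coding; last 2 first.
- exact: (dom_itv (visit x)).
- exact: (dom_itv (visit y)).
by rewrite /= !position_mass_before.
Qed.

Lemma coding_map_inj : injective f.
Proof. by move=> x y fxy; apply: mdist_positivity; rewrite -coding_map_dist fxy mdistxx. Qed.

Lemma coding_map_position (t : dom h) : f (p (val t)) = p_h t.
Proof.
apply/p_hP; rewrite d_h_coding ?dom_itv//.
by rewrite /= position_mass_before// mdistxx.
Qed.

Lemma preim_coding (A : set (T_h h)) :
  preim_h A = [set t | 0 <= t <= M /\ A (f (p t))].
Proof.
apply/seteqP; split=> [_ [t /= At <-]|t /= [tM At]].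
  by split; [exact: dom_itv|rewrite coding_map_position].
have tM' : t \in `[0, zeta h] by rewrite in_itv.
by exists (exist _ t tM') => //=; rewrite -coding_map_position.
Qed.

Lemma coding_map_root : f rho = rho_h h.
Proof.
apply/p_hP; rewrite d_h_coding ?dom_itv//.
by rewrite /= position_mass_before// position0 mdistxx.
Qed.

Lemma mass_before_position_le t : 0 <= t -> phi (p t) <= t.
Proof.
by move=> t0; have := mass_before_position treeT compT linle or1 or2 mes t; rewrite max_r.
Qed.

Lemma ell_coding x : ell_h (f x) = phi x.
Proof.
apply: inf_min; rewrite preim_coding /=.
  by rewrite mass_before_ge0 mass_before_le_total// position_mass_before.
by move=> t /= [/andP[t0 tM] /coding_map_inj <-]; exact: mass_before_position_le.
Qed.

Lemma le_coding x y : le x y -> le_h (f x) (f y).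
Proof. by rewrite /le_h !ell_coding mass_before_le. Qed.

End CodingFunction.

(** * The time spent in a Borel set is its mass *)

(** A copy of [T] pointed at its root, on which the pointed version of the
    finite cover theorem applies. *)
Definition rooted {R : realType} {T : metricType R} (rho : T) : Type := T.
HB.instance Definition _ {R : realType} {T : metricType R} (rho : T) :=
  PseudoMetric.copy (rooted rho) T.
HB.instance Definition _ {R : realType} {T : metricType R} (rho : T) :=
  isPointed.Build (rooted rho) rho.

Section CountableAncestors.
Context {R : realType} {T : metricType R} (rho : T).
Hypothesis treeT : real_tree T.
Hypothesis compT : compact [set: T].
Local Notation ht := (mdist rho).
Local Notation G := (gromov rho).

Lemma finite_net (e : R) : 0 < e ->
  exists s : seq T, forall x, exists2 y, y \in s & mdist x y < e.
Proof.
move=> e0; have : compact [set: rooted rho] by [].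
rewrite compact_cover => /(_ (rooted rho) setT (fun y => (ball y e)°)).
case=> [y _||D _ cD].
- exact: open_interior.
- move=> x _; exists x => //; exact: nbhsx_ballx.
exists (finmap.enum_fset D) => x; have [y yD /interior_subset yx] := cD x I.
exists y => //.
by move: yx; rewrite (@ballEmdist _ T) /= metric_sym.
Qed.

(** The ancestors at rational heights of the points of a countable dense set
    meet the upper part of every branch. *)
Lemma countable_ancestors : exists w : nat -> T,
  forall s c, 0 <= c -> c < ht s ->
    exists n, [/\ c < ht (w n), ht (w n) < ht s & ht (w n) <= G (w n) s].
Proof.
have N0 n : 0 < n.+1%:R^-1 :> R by rewrite invr_gt0.
pose net n := projT1 (cid (finite_net (N0 n))).
have netP n x : exists2 y, y \in net n & mdist x y < n.+1%:R^-1.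
  by rewrite /net; case: cid => s /= /(_ x).
pose w n := if @unpickle (nat * nat * rat)%type n is Some (a, b, q)
  then ancestor rho (nth rho (net a) b) (ratr q) else rho.
exists w => s c c0 cs; have [q] := rat_in_itvoo cs.
rewrite in_itv/= => /andP[cq qs].
have d0 : 0 < ht s - ratr q by rewrite subr_gt0.
have [a _ /(_ a (leqnn a)) /= ad] := near_infty_natSinv_lt (PosNum d0).
have [y yn ys] := netP a s.
exists (pickle (a, index y (net a), q)); rewrite /w pickleK nth_index//.
have qy : ratr q <= G y s.
  have := gromov_lip rho s y s; rewrite gromovxx; have := lt_trans ys ad; lra.
have [|-> qG] := @ancestorP _ _ rho treeT y (ratr q).
  by rewrite (le_trans c0 (ltW cq))/= (le_trans qy)// gromov_le.
by split => //; exact: (gromov_four_point treeT qG).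
Qed.

End CountableAncestors.

Section LeftContinuousMeasurable.
Context {R : realType} {T : metricType R} (rho : T).

(** The preimage of an open set is the union, over rational [a], of the sets of
    [t > a] such that the whole of ]a, t] lies in it; these sets are intervals. *)
Lemma left_continuous_measurable (q : R -> T) :
  (forall t e, 0 < e -> exists2 r0, r0 < t &
     forall r, r0 < r -> r <= t -> mdist (q r) (q t) < e) ->
  measurable_fun [set: R] (q : R -> borel rho).
Proof.
move=> qleft; apply: (measurability (@open T : set (set (borel rho)))) => //.
move=> _ [V oV <-]; rewrite setTI.
rewrite (_ : q @^-1` V = \bigcup_(a : rat)
  [set t | ratr a < t /\ forall r, ratr a < r -> r <= t -> V (q r)]).
  apply: countable_bigcupT_measurable => [|a]; first exact: countableP.
  apply: is_interval_measurable => x y [ax Vx] [ay Vy] t /andP[xt ty].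
  split; first exact: lt_le_trans xt.
  by move=> r ar rt; apply: Vy => //; exact: le_trans ty.
apply/seteqP; split=> [t /= Vt|t [a _ [at_ Vt]]]; last exact: Vt.
have [e /= e0 eV] : nbhs_ball (q t) V by apply/nbhs_ballP; exact: open_nbhs_nbhs.
have [r0 r0t r0e] := qleft t e e0.
have [a] := rat_in_itvoo r0t; rewrite in_itv/= => /andP[r0a at_].
exists a => //; split => // r ar rt; apply: eV.
by rewrite ballEmdist/= metric_sym; apply: r0e => //; exact: lt_trans ar.
Qed.

End LeftContinuousMeasurable.

Section IsometryBorel.
Context {R : realType} {T T' : metricType R}.

Lemma borel_preim_isometry (g : T -> T') (A : set T') :
  (forall x y, mdist (g x) (g y) = mdist x y) ->
  (<<s @open T' >>) A -> (<<s @open T >>) (g @^-1` A).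
Proof.
move=> gi; have sT := smallest_sigma_algebra [set: T] (@open T).
have : (<<s @open T' >>) `<=` [set A | (<<s @open T >>) (g @^-1` A)].
  apply: smallest_sub; last first.
    move=> V oV /=; apply: sub_sigma_algebra; apply: open_ballP => x /= Vx.
    have [e /= e0 eV] : nbhs_ball (g x) V by apply/nbhs_ballP; exact: open_nbhs_nbhs.
    by exists e => // y xy; apply: eV; rewrite ballEmdist/= gi.
  case: sT => sT0 sTC sTU; split => /=.
  - by rewrite preimage_set0.
  - by move=> B /sTC; rewrite !setTD preimage_setC.
  - by move=> F mF; rewrite preimage_bigcup; exact: sTU.
by apply.
Qed.

End IsometryBorel.

Section ExplorationMeasure.
Context {R : realType} {T : metricType R} (rho : T) (le : rel T).
Context (mu : {finite_measure set (borel rho) -> \bar R}).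
Hypothesis treeT : real_tree T.
Hypothesis compT : compact [set: T].
Hypothesis linle : linear_order le.
Hypothesis or1 : Or1 rho le.
Hypothesis or2 : Or2 rho le.
Hypothesis mes : Mes le mu.
Implicit Types (x y z u v s : T) (t r e c : R).
Local Notation ht := (mdist rho).
Local Notation G := (gromov rho).
Local Notation phi := (mass_before le mu).
Local Notation M := (total_mass mu).
Local Notation p := (position le mu).
Local Notation phi_le := (mass_before_le treeT linle or1 or2 mes).
Local Notation lambda := (@lebesgue_measure R).

Definition above u : set T := [set x | ht u <= G u x].

Definition subtrees : set (set T) := range above.

Lemma measurable_position : measurable_fun [set: R] (p : R -> borel rho).
Proof.
by apply: left_continuous_measurable => t e e0; exact: position_left.
Qed.

(** By left-continuity of [phi] along branches, countably many subtrees with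
    their roots in this set cover it. *)
Lemma mass_before_gt_subtrees c :
  (<<s subtrees >>) [set x | c < phi x].
Proof.
have abovesub u : (<<s subtrees >>) (above u).
  by apply: sub_sigma_algebra; exists u.
have [c0|c0] := ltP c 0.
  rewrite (_ : [set _ | _] = above rho); first exact: abovesub.
  apply/seteqP; split => x /= _; first by rewrite /above /= mdistxx gromov_ge0.
  exact: lt_le_trans (mass_before_ge0 _ _ _).
have [w wP] := countable_ancestors rho treeT compT.
rewrite (_ : [set _ | _] =
    \bigcup_n (if c < phi (w n) then above (w n) else set0)).
  apply: sigma_algebra_bigcup => n; case: ifP => _; first exact: abovesub.
  exact: sigma_algebra0.
apply/seteqP; split=> [x /= cx|x [n _]]; last first.
  case: ifPn => // cn xn; apply: lt_le_trans cn _; rewrite phi_le.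
  exact: (below_le treeT or1).
have [u [ux uG cu]] := mass_before_sup treeT linle or1 or2 c0 cx.
have [n [un nx nG]] := wP _ _ (mdist_ge0 _ _) ux.
exists n => //; rewrite (_ : _ < _)//; apply: lt_le_trans cu _; rewrite phi_le.
apply: (below_le treeT or1); apply: (gromov_four_point treeT uG).
by rewrite gromovC (le_trans (ltW un)).
Qed.

(** Since [p] is a left inverse of [phi], an open set is the preimage under
    [phi] of a Borel set of times. *)
Lemma borel_subtrees : @measurable _ (borel rho) = <<s subtrees >>.
Proof.
apply/seteqP; split; last first.
  apply: smallest_sub; first exact: smallest_sigma_algebra.
  by move=> _ [u _ <-]; exact: above_borel.
apply: smallest_sub; first exact: smallest_sigma_algebra.
move=> V oV.
have mphi : measurable_fun [set: g_sigma_algebraType (subtrees : set (set (pointed_at rho)))]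
    (phi : _ -> R).
  apply: (measurability _ (RGenOInfty.measurableE R)).
  move=> _ [_ [c ->] <-]; rewrite setTI.
  rewrite (_ : _ @^-1` _ = [set x | c < phi x]); first exact: mass_before_gt_subtrees.
  by apply/seteqP; split => x /=; rewrite in_itv/= andbT.
have mV := measurable_position measurableT (open_borel oV).
have := mphi measurableT _ mV; rewrite !setTI.
rewrite (_ : _ @^-1` _ = V)//; apply/seteqP; split => x /=;
  by rewrite position_mass_before.
Qed.

Lemma measurable_mass_before :
  measurable_fun [set: borel rho] (phi : borel rho -> R).
Proof.
apply: (measurability _ (RGenOInfty.measurableE R)).
move=> _ [_ [c ->] <-]; rewrite setTI borel_subtrees.
rewrite (_ : _ @^-1` _ = [set x | c < phi x]); first exact: mass_before_gt_subtrees.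
by apply/seteqP; split => x /=; rewrite in_itv/= andbT.
Qed.

(** The roots of two subtrees with a common point are on the same branch, so the
    subtrees are nested; otherwise they are disjoint. *)
Lemma subtrees_setI : setI_closed (subtrees `|` [set set0]).
Proof.
have nested u v x : ht u <= ht v -> above u x -> above v x -> above v `<=` above u.
  move=> uv ux vx y vy; apply: (gromov_four_point treeT (y := v)).
    by apply: (gromov_four_point treeT ux); rewrite gromovC (le_trans uv).
  exact: le_trans uv vy.
move=> _ _ [[u _ <-]|->] [[v _ <-]|->]; rewrite ?setI0 ?set0I; [|by right..].
have [->|/set0P[x [ux vx]]] := eqVneq (above u `&` above v) set0; first by right.
left; have [uv|/ltW vu] := leP (ht u) (ht v).
  by rewrite setIidr; [exists v|exact: nested uv ux vx].
by rewrite setIidl; [exists u|exact: nested vu vx ux].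
Qed.

Lemma mass_le_before (A : set T) s : measurable (A : set (borel rho)) ->
  (forall u v, A v -> le u v -> A u) -> ~ A s -> (mu A <= (phi s)%:E)%E.
Proof.
move=> mA downA nAs; rewrite mass_beforeE//.
apply: le_measure; rewrite ?inE//; first exact: before_borel.
by move=> v Av /=; rewrite strictP//; apply/negP => sv; apply: nAs; exact: downA sv.
Qed.

(** A set closed downwards is exhausted at the time equal to its mass: just
    after that time the exploration has already entered its complement. *)
Lemma mass_down_exit (A : set T) t : measurable (A : set (borel rho)) ->
  (forall u v, A v -> le u v -> A u) -> (mu A < t%:E)%E -> t <= M ->
  exists2 s, ~ A s & phi s <= t.
Proof.
move=> mA downA At tM; apply: contrapT => no.
have tE s : ~ A s -> t < phi s.
  by move=> As; rewrite ltNge; apply/negP => st; apply: no; exists s.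
pose P := [set phi s | s in ~` A].
have P0 : P !=set0.
  have [AT|/existsNP[s As]] := pselect (forall s, A s); last by exists (phi s), s.
  move: At; rewrite (_ : A = setT) -?total_massE ?lte_fin ?ltNge ?tM//.
  by apply/seteqP; split => // s _; exact: AT.
have lbP : has_lbound P by exists t => _ [s As <-]; exact/ltW/tE.
have infP : has_inf P by split.
pose c := inf P; have tc : t <= c.
  by apply: lb_le_inf => // _ [s As <-]; exact/ltW/tE.
have cE s : ~ A s -> c <= phi s by move=> As; apply: ge_inf => //; exists s.
have [[s As cs]|nattained] := pselect (exists2 s, ~ A s & phi s = c).
  have : (mu [set v | strict le v s] <= mu A)%E.
    apply: le_measure; rewrite ?inE//; first exact: before_borel.
    move=> v /= vs; apply: contrapT => /cE; rewrite -cs phi_le.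
    by move: vs; rewrite strictP// => /negP.
  rewrite -mass_beforeE// leNgt; case/negP.
  by apply: lt_le_trans At _; rewrite lee_fin cs.
pose X n := [set v | phi v < c + n.+1%:R^-1].
have mX n : measurable (X n : set (borel rho)).
  rewrite (_ : X n = setT `&` phi @^-1` `]-oo, c + n.+1%:R^-1[).
    exact: measurable_mass_before.
  by rewrite setTI; apply/seteqP; split => v /=; rewrite in_itv.
have capX : \bigcap_n X n = A.
  apply/seteqP; split=> [v Xv|v Av n _].
    apply: contrapT => Av; apply: nattained; exists v => //.
    apply/le_anti; rewrite cE// andbT; apply/ler_addgt0Pr => e e0.
    have [n _ /(_ n (leqnn n)) /= ne] := near_infty_natSinv_lt (PosNum e0).
    by have := Xv n I; rewrite /X /=; move: ne; set a := _^-1; lra.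
  have n0 : 0 < n.+1%:R^-1 :> R by rewrite invr_gt0.
  have [_ [s As <-] sn] := inf_adherent n0 infP.
  rewrite /X /=; apply: le_lt_trans sn; rewrite phi_le.
  case: (linle) => _ _ _ tot; have /orP[//|sv] := tot v s.
  by case: As; exact: downA sv.
have cvgX : (mu \o X) n @[n --> \oo] --> mu A.
  rewrite -capX; apply: nonincreasing_cvg_mu => //.
  - by rewrite -ge0_fin_numE//; exact: fin_num_measure.
  - by rewrite capX.
  - move=> m n mn; apply/subsetPset => v /= vn; apply: lt_le_trans vn _.
    by rewrite lerD2l lef_pV2 ?posrE// ler_nat ltnS.
have : (t%:E <= limn (mu \o X))%E.
  apply: lime_ge; first by apply/cvg_ex; exists (mu A).
  apply: nearW => n /=; have n0 : 0 < n.+1%:R^-1 :> R by rewrite invr_gt0.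
  have [_ [s As <-] sn] := inf_adherent n0 infP.
  apply: (@le_trans _ _ (phi s)%:E); first by rewrite lee_fin ltW// tE.
  rewrite mass_beforeE//; apply: le_measure; rewrite ?inE//; first exact: before_borel.
  move=> v /=; rewrite strictP// => /negP sv; apply: lt_trans sn.
  by rewrite ltNge phi_le; exact/negP.
by rewrite (cvg_lim (@ereal_hausdorff R) cvgX) leNgt At.
Qed.

Section SubtreeTimes.
Variable u : T.

Definition until_subtree : set T := [set v | strict le v u] `|` above u.

Let until_borel : measurable (until_subtree : set (borel rho)).
Proof. by apply: measurableU; [exact: before_borel|exact: above_borel]. Qed.

Let until_above s : le u s -> until_subtree s -> above u s.
Proof. by move=> us [/=|//]; rewrite strictP// us. Qed.

Let until_down s v : until_subtree v -> le s v -> until_subtree s.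
Proof.
move=> Dv sv; have [us|nus] := boolP (le u s); last by left; rewrite /= strictP.
right; case: (linle) => _ _ tr _.
have uv := until_above (tr _ _ _ us sv) Dv.
exact: le_trans uv (order_gromov treeT or2 us sv).
Qed.

Definition subtree_mass : R := fine (mu (above u)).

Lemma subtree_massE : mu (above u) = subtree_mass%:E.
Proof. by rewrite fineK//; apply: fin_num_measure; exact: above_borel. Qed.

Lemma subtree_mass_ge0 : 0 <= subtree_mass.
Proof. exact: fine_ge0. Qed.

Let until_mass : mu until_subtree = (phi u + subtree_mass)%:E.
Proof.
rewrite EFinD mass_beforeE// -subtree_massE; apply: measureU.
- exact: before_borel.
- exact: above_borel.
- apply/seteqP; split => // v [/= + vu]; rewrite strictP//.
  by rewrite (below_le treeT or1 vu).
Qed.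

Lemma subtree_mass_total : phi u + subtree_mass <= M.
Proof.
rewrite -lee_fin -until_mass total_massE; apply: le_measure => //; rewrite inE//.
Qed.

(** The exploration is inside a subtree during an interval of time, whose
    length is the mass of the subtree. *)
Lemma position_in_subtree t :
  phi u <= t -> t < phi u + subtree_mass -> above u (p t).
Proof.
move=> ut te; apply/ler_addgt0Pr => e e0.
have t0 : 0 <= t by exact: le_trans (mass_before_ge0 _ _ _) ut.
have [|s [st us sd]] := @position_near _ _ _ _ mu treeT compT linle or1 or2 t u _ e0.
  by rewrite /visited /= max_r.
have /(until_above us) : until_subtree s.
  apply: contrapT => Ds.
  have := mass_le_before until_borel until_down Ds.
  rewrite until_mass lee_fin leNgt; case/negP; apply: le_lt_trans te.
  by move: st; rewrite /visited /= max_r.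
rewrite /above /= gromovC => us'.
by have := gromov_lip rho s (p t) u; rewrite (gromovC _ (p t)); lra.
Qed.

Lemma subtree_position t : 0 <= t -> t <= M -> above u (p t) ->
  phi u <= t <= phi u + subtree_mass.
Proof.
move=> t0 tM ut; apply/andP; split.
  apply: (@le_trans _ _ (phi (p t))); first by rewrite phi_le (below_le treeT or1).
  exact: mass_before_position_le.
rewrite leNgt; apply/negP => et.
have [|s Ds st] := mass_down_exit until_borel until_down _ tM.
  by rewrite until_mass lte_fin.
have us : le u s.
  by apply: contrapT => /negP us; apply: Ds; left; rewrite /= strictP.
have us' : phi u <= phi s by rewrite phi_le.
have := position_between mu treeT compT linle or1 or2 us' st.
by rewrite !position_mass_before// => H; apply: Ds; right; exact: le_trans ut H.
Qed.

End SubtreeTimes.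

Let measurable_preim (A : set T) : measurable (A : set (borel rho)) ->
  measurable (p @^-1` A).
Proof. by move=> mA; rewrite -[X in measurable X]setTI; exact: measurable_position. Qed.

(** Subtrees and the empty set form a generating pi-system, so it is enough that
    the exploration spends the right time in each subtree. *)
Lemma exploration_measure (A : set T) : measurable (A : set (borel rho)) ->
  lambda (p @^-1` A `&` `[0, M]) = mu A.
Proof.
have mI : measurable (`[0, M] : set R) by exact: measurable_itv.
pose nu := measure_function_pushforward__canonical__measure_function_Measure
  (mrestr lambda mI) measurable_position.
rewrite -[LHS]/(nu A).
have above_root : above rho = setT.
  by apply/seteqP; split => // x _; rewrite /above /= mdistxx gromov_ge0.
have M0 := total_mass_ge0 mu.
apply: (@measure_unique _ R (borel rho) (subtrees `|` [set set0]) (fun=> setT) _ _ _ _ nu mu).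
- rewrite borel_subtrees; apply/seteqP; split.
    by apply: sub_sigma_algebra2 => ?; left.
  apply: smallest_sub; first exact: smallest_sigma_algebra.
  by move=> B [|->]; [exact: sub_sigma_algebra|exact: sigma_algebra0].
- exact: subtrees_setI.
- by move=> _; left; exists rho.
- by rewrite bigcup_const.
- move=> B [[u _ <-]|->]; last by rewrite !measure0.
  have m0 := subtree_mass_ge0 u; have phi0 := mass_before_ge0 le mu u.
  have um : phi u <= phi u + subtree_mass u by rewrite lerDl.
  have Em := subtree_mass_total u.
  apply: etrans (esym (subtree_massE u)); apply/le_anti/andP; split.
    apply: (@le_trans _ _ (lambda `[phi u, phi u + subtree_mass u])).
      apply: le_measure; rewrite ?inE.
      + by apply: measurableI => //; apply: measurable_preim; exact: above_borel.
      + exact: measurable_itv.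
      + move=> t [/= ut]; rewrite !in_itv/= => /andP[t0 tM].
        exact: subtree_position.
    by rewrite lebesgue_measure_bnd// addrC addKr.
  apply: (@le_trans _ _ (lambda `[phi u, phi u + subtree_mass u[)).
    by rewrite lebesgue_measure_bnd// addrC addKr.
  apply: le_measure; rewrite ?inE.
  + exact: measurable_itv.
  + by apply: measurableI => //; apply: measurable_preim; exact: above_borel.
  + move=> t /=; rewrite !in_itv/= => /andP[ut te]; split.
      exact: position_in_subtree.
    by rewrite (le_trans phi0 ut)/= ltW// (lt_le_trans te).
- move=> _ /=; rewrite /pushforward /mrestr preimage_setT setTI.
  by rewrite lebesgue_measure_bnd// ltry.
Qed.

Local Notation h := (coding_height treeT compT linle or1 or2 mes).
Local Notation f := (coding_map treeT compT linle or1 or2 mes).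

Lemma mu_coding (A : set (T_h h)) : (<<s @open (T_h h) >>) A ->
  mu_h A = mu (f @^-1` A).
Proof.
move=> mA; rewrite -exploration_measure; last first.
  exact: borel_preim_isometry (coding_map_dist _ _ _ _ _ _) mA.
rewrite /mu_h preim_coding; congr (lambda _); apply/seteqP; split=> t /=;
  by rewrite in_itv/= => -[].
Qed.

(** The times at which the position precedes [u] have total length [phi u], and
    those up to [phi u] already account for it. *)
Lemma late_negligible u :
  lambda.-negligible [set t | [/\ 0 <= t, t <= M, phi u <= t & strict le (p t) u]].
Proof.
set N := [set t | _].
have mb : measurable ([set v | strict le v u] : set (borel rho)) by exact: before_borel.
have mN : measurable N.
  rewrite (_ : N = p @^-1` [set v | strict le v u] `&` (`[0, M] `&` `[phi u, +oo[)).
    apply: measurableI; first exact: measurable_preim.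
    by apply: measurableI; exact: measurable_itv.
  apply/seteqP; split=> t /=; rewrite !in_itv/= andbT.
    by move=> [-> -> -> ->].
  by move=> [pt [/andP[t0 tM] ut]].
exists N; split => //.
have phi0 := mass_before_ge0 le mu u; have phiM := mass_before_le_total mu treeT linle or1 or2 u.
have := exploration_measure mb; rewrite -mass_beforeE//.
rewrite (_ : _ `&` _ = `[0, phi u[ `|` N); last first.
  apply/seteqP; split=> t /=; rewrite !in_itv/=.
    by move=> [pt /andP[t0 tM]]; have [tu|ut] := ltP t (phi u); [left|right];
      rewrite ?t0.
  move=> [/andP[t0 tu]|[t0 tM ut pt]]; last by rewrite t0.
  rewrite t0 (le_trans (ltW tu))//; split => //.
  rewrite strictP// -phi_le -ltNge; apply: le_lt_trans tu.
  exact: mass_before_position_le.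
rewrite measureU//; last first.
  apply/seteqP; split => // t [/=]; rewrite in_itv/= => /andP[_ tu] [_ _ + _].
  by rewrite leNgt tu.
move=> H; have {H} : ((phi u)%:E + lambda N = (phi u)%:E)%E.
  by rewrite -{1}[phi u]subr0 -(lebesgue_measure_bnd true true phi0).
move=> /(congr1 (fun a : \bar R => a - (phi u)%:E)%E).
by rewrite subee// addeAC subee// add0e.
Qed.

(** If the position at [t] is not the last point visited by then, it precedes
    some visited point, and even one of a countable cofinal family of ancestors:
    such times are negligible. At any other time the exploration has stayed at
    its current position since the first visit to it. *)
Lemma min_coding : Min h.
Proof.
suff : lambda.-negligible (S_h h) by move=> /negligible_outer_measure.
have [w wP] := countable_ancestors rho treeT compT.
pose N n : set R := [set t | [/\ 0 <= t, t <= M, phi (w n) <= t & strict le (p t) (w n)]].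
have : lambda.-negligible (\bigcup_n N n).
  by apply: negligible_bigcup => n; exact: late_negligible.
apply: negligibleS.
move=> t [/= + nF]; rewrite in_itv/= => /andP[t0 tM]; apply: contrapT => nN.
apply: nF; exists (f (p t)) => //=; rewrite in_itv/= ell_coding.
rewrite mass_before_position_le//=.
have maxt s : phi s <= t -> le s (p t).
  move=> st; apply: contrapT => /negP; rewrite -strictP// => ps.
  have [n [Gn ns nG]] := wP _ _ (gromov_ge0 _ _ _) (strict_gromov_lt treeT linle or1 ps).
  have [pn /andP[_ ns']] := strict_ancestor treeT linle or1 or2 ps Gn ns nG.
  apply: nN; exists n => //; split => //; apply: le_trans st.
  by rewrite phi_le.
have pconst r : phi (p t) <= r -> r <= t -> p r = p t.
  move=> pr rt; have r0 : 0 <= r by exact: le_trans (mass_before_ge0 _ _ _) pr.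
  apply: (position_max treeT compT linle or1 or2); rewrite /visited /= max_r//.
  by move=> s /le_trans/(_ rt)/maxt.
rewrite /r_h; case: ifPn => [//|/set0P A0].
apply: lb_le_inf => // r [/=]; rewrite ell_coding preim_coding /= => pr [_ neq].
rewrite leNgt; apply/negP => rt; apply: neq.
by rewrite (pconst r (ltW pr) (ltW rt)).
Qed.

End ExplorationMeasure.

(** * A height function satisfying (Min) is determined by its tree *)

Section HeightGeometry.
Context {R : realType} (h : height R).
Implicit Types (r s t a e : R) (x y : T_h h).
Local Notation Z := (zeta h).
Local Notation lambda := (@lebesgue_measure R).

Lemma d_h_eq0 s t : d_h h s t = 0 -> h s = m_h h s t /\ h t = m_h h s t.
Proof.
rewrite /d_h; have := m_h_lel h s t; have := m_h_ler h s t.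
by move=> *; split; lra.
Qed.

Lemma d_h_const s t : s <= t -> (forall r, s <= r -> r <= t -> h r = h s) ->
  d_h h s t = 0.
Proof.
move=> st hc; have : m_h h s t = h s.
  apply/le_anti; rewrite m_h_lel; apply: le_m_h => r; rewrite min_l// max_r//.
  by move=> /andP[sr rt]; rewrite hc.
by rewrite /d_h => ->; rewrite (hc t)//; lra.
Qed.

Lemma height_left t e : 0 < t <= Z -> 0 < e ->
  exists d, [/\ 0 <= d, d < t & forall r, d < r -> r <= t -> `|h r - h t| < e].
Proof.
move=> tZ e0; have /andP[t0 _] := tZ.
have /cvgrPdist_lt/(_ e e0) := hval_lcont tZ.
rewrite near_withinE => /nbhs_ballP[d /= d0 dP].
exists (Num.max 0 (t - d)); split; first by rewrite le_max lexx.
  by rewrite gt_max t0; lra.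
move=> r; rewrite gt_max => /andP[r0 dr]; rewrite le_eqVlt => /predU1P[->|rt].
  by rewrite subrr normr0.
rewrite distrC; apply: dP => //; rewrite /ball/= ger0_norm; lra.
Qed.

(** Heights are left-continuous and only jump downwards, so they cannot cross a
    level upwards without taking it: the last time before a visit to [x] at which
    the height is below that of [x] is a visit to [x], and the first one. *)
Lemma ell_attained x : exists2 t : dom h, p_h t = x & val t = ell_h x.
Proof.
pose d1 := repr x; have d1x : p_h d1 = x := p_h_repr x.
set t1 : R := val d1; have : 0 <= t1 <= Z by have := valP d1; rewrite in_itv.
move=> /andP[t10 t1Z]; pose H := h t1.
suff [s [s0 st1 hs sle slb]] : exists s, [/\ 0 <= s, s <= t1, h s = H,
    forall r, s <= r -> r <= t1 -> H <= h r &
    forall t, 0 <= t -> t < s -> d_h h t t1 != 0].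
  have sZ : s \in `[0, Z] by rewrite in_itv/= s0 (le_trans st1).
  have sx : p_h (exist _ s sZ : dom h) = x.
    rewrite -d1x; apply/p_hP => /=; rewrite -/t1.
    have : m_h h s t1 = H.
      apply/le_anti; rewrite m_h_ler; apply: le_m_h => r.
      by rewrite min_l// max_r// => /andP[sr rt]; exact: sle.
    by rewrite /d_h hs => ->; rewrite -/H; lra.
  exists (exist _ s sZ) => //=; apply/esym; apply: inf_min.
    by exists (exist _ s sZ).
  move=> _ [t /= tx <-]; rewrite leNgt; apply/negP => ts.
  have t0 : 0 <= val t by have := valP t; rewrite in_itv => /andP[].
  have /eqP := slb _ t0 ts; apply; apply/(p_hP t d1).
  by rewrite d1x.
pose A := [set r | [/\ 0 <= r, r <= t1 & h r < H]].
have [A0|/set0P A0] := eqVneq A set0.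
  have geH r : 0 <= r -> r <= t1 -> H <= h r.
    move=> r0 rt; rewrite leNgt; apply/negP => rH.
    by have : A r by []; rewrite A0.
  exists 0; split => //.
    by apply/le_anti; rewrite geH// hval0 height_ge0.
  by move=> t t0 /(le_lt_trans t0); rewrite ltxx.
have supA : has_sup A by split => //; exists t1 => r [].
pose s := sup A.
have sA r : A r -> r <= s by move=> Ar; apply: sup_ubound => //; exact: supA.2.
have s0 : 0 <= s by case: A0 => r Ar; have [r0 _ _] := Ar; rewrite (le_trans r0)// sA.
have st1 : s <= t1 by apply: ge_sup => // r [].
have after r : s < r -> r <= t1 -> H <= h r.
  move=> sr rt; rewrite leNgt; apply/negP => rH.
  by have := sA r; rewrite leNgt sr => /(_ _)/negP; apply; split => //; lra.
have hsH : h s <= H.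
  have [->|sn0] := eqVneq s 0; first by rewrite hval0 height_ge0.
  rewrite leNgt; apply/negP => Hs.
  have [||d [d0 ds dP]] := @height_left s (h s - H).
  - by rewrite lt_neqAle eq_sym sn0 s0 (le_trans st1).
  - by rewrite subr_gt0.
  have sd0 : 0 < s - d by rewrite subr_gt0.
  have [r Ar] := sup_adherent sd0 supA; rewrite subKr => dr.
  have := dP r dr (sA _ Ar); have [_ _ rH] := Ar.
  by rewrite ltr_norml => /andP[+ _]; lra.
have Hhs : H <= h s.
  move: (st1); rewrite le_eqVlt => /predU1P[->//|slt].
  have sZ : 0 <= s < Z by rewrite s0 (lt_le_trans slt).
  apply: (@le_trans _ _ (lim (h x @[x --> s^'+]))).
    apply: limr_ge; first exact: hval_rlim.
    near=> r; apply: after; near: r; [exact: nbhs_right_gt|exact: nbhs_right_le].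
  by rewrite -subr_ge0 hval_jump.
have hs : h s = H by apply/le_anti; rewrite hsH.
exists s; split => //.
  by move=> r; rewrite le_eqVlt => /predU1P[<- _|]; [rewrite hs|exact: after].
move=> t t0 ts; apply/eqP => /d_h_eq0[_ Hm].
have st0 : 0 < s - t by rewrite subr_gt0.
have [r Ar] := sup_adherent st0 supA; rewrite subKr => tr.
have [r0 rt rH] := Ar; move: rH; rewrite ltNge /H Hm; case/negP.
by apply: m_h_le; rewrite min_l ?max_r ?(ltW tr)// ltW// (lt_le_trans ts).
Unshelve. all: by end_near. Qed.

Lemma preim_h1 x t : preim_h [set x] t <-> 0 <= t <= Z /\ d_h h (ell_h x) t = 0.
Proof.
have [s <- sE] := ell_attained x; rewrite -sE; split.
  move=> [t' /= /esym/p_hP st <-]; split => //.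
  by have := valP t'; rewrite in_itv.
move=> [tZ st]; have tZ' : t \in `[0, Z] by rewrite in_itv.
by exists (exist _ t tZ') => //=; apply/esym/p_hP.
Qed.

Lemma ell_itv x : 0 <= ell_h x <= Z.
Proof. by have [s _ <-] := ell_attained x; have := valP s; rewrite in_itv. Qed.

Lemma ell_inj : injective (@ell_h R h).
Proof.
move=> x y; have [s <- <-] := ell_attained x; have [t <- <-] := ell_attained y.
by move=> st; congr p_h; exact: val_inj.
Qed.

Lemma ell_le x t : preim_h [set x] t -> ell_h x <= t.
Proof.
move=> xt; apply: ge_inf => //; exists 0 => _ [s _ <-].
by have := valP s; rewrite in_itv => /andP[].
Qed.

(** During the stay at [x] that follows its first visit the height is constant;
    left-continuity adds the right end of that stay. *)
Lemma stay_const x t r : ell_h x <= t -> t <= r_h x -> t <= Z ->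
  ell_h x <= r -> r <= t -> preim_h [set x] r.
Proof.
move=> xt tr tZ.
have ell0 : 0 <= ell_h x by case/andP: (ell_itv x).
have before r' : ell_h x <= r' -> r' < t -> preim_h [set x] r'.
  rewrite le_eqVlt => /predU1P[<- _|xr rt'].
    by apply/preim_h1; rewrite ell_itv d_hxx.
  have rZ : r' \in `[0, Z] by rewrite in_itv/=; apply/andP; split; lra.
  apply: contrapT => nx; have nx' : ([set t | ell_h x < t] `&` preim_h (~` [set x])) r'.
    split => //; exists (exist _ r' rZ) => //= E; apply: nx.
    by exists (exist _ r' rZ).
  move: tr; rewrite /r_h; case: ifPn => [/eqP E|_]; first by rewrite E in nx'.
  rewrite leNgt; case/negP; apply: le_lt_trans rt'; apply: ge_inf => //.
  by exists (ell_h x) => q [/= /ltW].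
move=> xr; rewrite le_eqVlt => /predU1P[->|]; last exact: before.
move: (xt); rewrite le_eqVlt => /predU1P[<-|xlt].
  by apply/preim_h1; rewrite ell_itv d_hxx.
apply/preim_h1; split; first by rewrite tZ andbT (le_trans ell0).
have hc r' : ell_h x <= r' -> r' < t -> h r' = h (ell_h x).
  by move=> xr' rt; have /preim_h1[_ /d_h_eq0[-> ->]] := before _ xr' rt.
apply: d_h_const => // r' xr'; rewrite le_eqVlt => /predU1P[->|]; last exact: hc.
apply/eqP; rewrite -subr_eq0 -normr_le0; apply/ler_addgt0Pr => e e0; rewrite add0r.
have [|d [d0 dt dP]] := @height_left t e _ e0.
  by rewrite tZ andbT (le_lt_trans ell0).
pose q := Num.max (ell_h x) ((d + t) / 2).
have qt : q < t by rewrite gt_max xlt; lra.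
have dq : d < q by rewrite lt_max; apply/orP; right; lra.
have := dP q dq (ltW qt); rewrite (hc q) ?le_max ?lexx// distrC; exact: ltW.
Qed.

(** At almost every time the current point has not been left since its first
    visit, so that the time spent strictly before [x] is the first visit time
    of [x]. *)
Lemma mu_h_before x : Min h -> mu_h [set y : T_h h | ell_h y < ell_h x] = (ell_h x)%:E.
Proof.
move=> minh; have /andP[l0 lZ] := ell_itv x.
have bnd (a b : bool) : lambda [set` Interval (BSide a 0) (BSide b (ell_h x))] = (ell_h x)%:E.
  by rewrite lebesgue_measure_bnd// subr0.
apply/le_anti/andP; split; last first.
  rewrite -(bnd true true); apply: le_lebesgue_measure => t /=.
  rewrite in_itv/= => /andP[t0 tx].
  have tZ : t \in `[0, Z] by rewrite in_itv/= t0 (le_trans (ltW tx)).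
  exists (exist _ t tZ) => //=; apply: le_lt_trans tx.
  by apply: ell_le; exists (exist _ t tZ).
have : lambda.-negligible (S_h h) by apply/negligible_outer_measure.
move=> [B [mB B0 SB]].
apply: (@le_trans _ _ (lambda (`[0, ell_h x]%classic `|` B))); last first.
  apply: (@le_trans _ _ (lambda `[0%R, ell_h x]%classic + lambda B)%E).
    by apply: measureU2 => //; exact: measurable_itv.
  by rewrite B0 adde0 bnd.
apply: le_lebesgue_measure => _ [t /= tx <-].
have : 0 <= val t <= Z by have := valP t; rewrite in_itv.
move=> /andP[t0 tZ].
have [tl|lt] := leP (val t) (ell_h x); first by left; rewrite /= in_itv/= t0.
right; apply: SB; split; first by rewrite /= in_itv/= t0.
move=> [y _ /=]; rewrite in_itv/= => /andP[yt tr].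
have [t' /= yt' /val_inj E] := stay_const yt tr tZ yt (lexx _).
rewrite E in yt'; rewrite /= yt' in tx.
have [s /= ys sx] := stay_const yt tr tZ (ltW tx) (ltW lt).
have [s' s'x s'E] := ell_attained x.
have ss : s = s' by apply: val_inj; rewrite s'E.
by move: tx; rewrite -ys ss s'x ltxx.
Qed.

Lemma mu_h_total : @mu_h R h [set: T_h h] = Z%:E.
Proof.
rewrite /mu_h (_ : preim_h _ = `[0, Z]%classic).
  by rewrite lebesgue_measure_bnd ?zeta_ge0// subr0.
apply/seteqP; split=> [_ [t _ <-]|t tZ]; first exact: valP.
by exists (exist _ t tZ).
Qed.

Lemma height_ell x : h (ell_h x) = mdist (rho_h h) x.
Proof.
have [s <- <-] := ell_attained x.
rewrite [mdist _ _]dist_hE /d_h /= hval0.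
suff -> : m_h h 0 (val s) = 0 by lra.
apply/le_anti/andP; split; first by rewrite -[leRHS](hval0 h) m_h_lel.
by apply: le_m_h => r _; exact: height_ge0.
Qed.

Lemma ell_root : ell_h (rho_h h) = 0.
Proof.
apply: inf_min; first by exists (dom0 h).
by move=> _ [s _ <-]; have := valP s; rewrite in_itv => /andP[].
Qed.

(** Under (Min) a height function is determined by its values at first visit
    times: a time either belongs to the stay that follows a first visit, or is
    a limit from the left of first visit times. *)
Lemma height_determined t e : Min h -> 0 <= t <= Z -> 0 < e ->
  exists2 x : T_h h, ell_h x <= t &
    forall y : T_h h, ell_h x <= ell_h y -> ell_h y <= t -> `|h (ell_h y) - h t| < e.
Proof.
move=> minh /andP[t0 tZ] e0.
have stay x : ell_h x <= t -> t <= r_h x ->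
    forall y, ell_h x <= ell_h y -> ell_h y <= t -> `|h (ell_h y) - h t| < e.
  move=> xt tr y xy yt.
  have /preim_h1[_ /d_h_eq0[yx ->]] := stay_const xt tr tZ xy yt.
  have /preim_h1[_ /d_h_eq0[tx ->]] := stay_const xt tr tZ xt (lexx _).
  by rewrite -yx -tx subrr normr0.
have [[x _ /=]|tS] := pselect (F_h h t).
  by rewrite in_itv/= => /andP[xt tr]; exists x => //; exact: stay.
have tn0 : t != 0.
  apply: contra_notN tS => /eqP ->; exists (rho_h h) => //=.
  rewrite in_itv/= ell_root lexx/= /r_h; case: ifPn => [_|/set0P A0].
    exact: zeta_ge0.
  by apply: lb_le_inf => // r [/=]; rewrite ell_root => /ltW.
have [|d [d0 dt dP]] := @height_left t e _ e0; first by rewrite lt_neqAle eq_sym tn0 t0.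
have [[x dx xt]|nox] := pselect (exists2 x : T_h h, d < ell_h x & ell_h x <= t).
  by exists x => // y xy yt; apply: dP => //; exact: lt_le_trans xy.
have early x : ell_h x <= t -> ell_h x <= d.
  by move=> xt; rewrite leNgt; apply/negP => dx; apply: nox; exists x.
have dZ : d \in `[0, Z] by rewrite in_itv/= d0 (le_trans (ltW dt)).
pose x := p_h (exist _ d dZ : dom h).
have xd : ell_h x <= d by apply: ell_le; exists (exist _ d dZ).
have dense a : d <= a -> a < t -> exists2 r, a < r < t & F_h h r.
  move=> da at_; apply: contrapT => no.
  have : (lambda `]a, t[ <= lambda (S_h h))%E.
    apply: le_lebesgue_measure => r /=; rewrite in_itv/= => /andP[ar rt].
    split; first by rewrite /= in_itv/=; apply/andP; split; lra.
    by move=> Fr; apply: no; exists r => //; rewrite ar.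
  by rewrite lebesgue_measure_bnd ?(ltW at_)// minh lee_fin leNgt subr_gt0 at_.
have stayx r : ell_h x <= r -> r < t -> preim_h [set x] r.
  move=> xr rt; have [||q /andP[rq qt] [y _ /=]] := dense (Num.max d r).
  - by rewrite le_max lexx.
  - by rewrite gt_max dt.
  rewrite in_itv/= => /andP[yq qy]; move: rq; rewrite gt_max => /andP[dq rq].
  have qZ : q <= Z by lra.
  have yd := early y (le_trans yq (ltW qt)).
  have [s /= sy sd] := stay_const yq qy qZ yd (ltW dq).
  have yx : y = x by rewrite -sy; congr p_h; exact: val_inj.
  by rewrite yx in yq qy; exact: stay_const yq qy qZ xr (ltW rq).
case: tS; exists x => //=; rewrite in_itv/= (le_trans xd (ltW dt))/=.
rewrite /r_h; case: ifPn => [_//|/set0P A0].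
apply: lb_le_inf => // r [/= xr [s /= nsx sr]]; rewrite leNgt; apply/negP => rt.
have [s' /= s'x s'r] := stayx r (ltW xr) rt.
by apply: nsx; rewrite -s'x; congr p_h; apply: val_inj; exact: etrans sr (esym s'r).
Qed.

End HeightGeometry.

Section Uniqueness.
Context {R : realType} {T : metricType R} (rho : T) (le : rel T).
Context (mu : {finite_measure set (borel rho) -> \bar R}).
Hypothesis treeT : real_tree T.
Hypothesis linle : linear_order le.
Hypothesis or1 : Or1 rho le.
Hypothesis or2 : Or2 rho le.
Hypothesis mes : Mes le mu.
Local Notation phi := (mass_before le mu).

Definition codes (h : height R) : Prop :=
  Min h /\ equivalent rho le mu (rho_h h) (@le_h R h) (@mu_h R h).

Lemma codes_zeta h : codes h -> zeta h = total_mass mu.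
Proof.
move=> [_ [f [_ _ _ _ fmu]]].
have [s0 sC _] := smallest_sigma_algebra [set: T_h h] (@open (T_h h)).
have := sC _ s0; rewrite setD0 => /fmu.
by rewrite preimage_setT mu_h_total -total_massE => -[].
Qed.

(** The points strictly before [s] have mass [phi s]; the times strictly before
    their images fill the times before the first visit of the image of [s]. *)
Lemma codes_first_visit h : codes h -> exists f : T -> T_h h,
  [/\ forall s, ell_h (f s) = phi s, forall s, h (phi s) = mdist rho s &
      forall y, exists s, f s = y].
Proof.
move=> [minh [f [fi fsurj froot fle fmu]]].
have fs y : exists s, f s = y.
  by have : [set: T_h h] y by []; rewrite -fsurj => -[s _ <-]; exists s.
have finj : injective f.
  by move=> x y fxy; apply: mdist_positivity; rewrite -fi fxy mdistxx.
have fell s : ell_h (f s) = phi s.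
  pose g y := projT1 (cid (fs y)); have fg y : f (g y) = y by rewrite /g; case: cid.
  have gi x y : mdist (g x) (g y) = mdist x y by rewrite -fi !fg.
  pose A := [set y : T_h h | ell_h y < ell_h (f s)].
  have fA : f @^-1` A = [set v | strict le v s].
    apply/seteqP; split=> v /=; rewrite /A /= strictP//.
      by apply: contraTN => /fle; rewrite /le_h -leNgt.
    move=> nsv; rewrite lt_neqAle; apply/andP; split.
      by apply: contra nsv => /eqP/ell_inj/finj ->; case: linle.
    apply: fle; case: linle => _ _ _ tot; have := tot v s.
    by rewrite (negbTE nsv) orbF.
  have gA : A = g @^-1` [set v | strict le v s].
    by rewrite -fA; apply/seteqP; split => y /=; rewrite fg.
  have mA : (<<s @open (T_h h) >>) A.
    have := borel_preim_isometry gi (before_borel treeT linle or1 or2 s).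
    by rewrite -gA.
  have := fmu A mA; rewrite fA -mass_beforeE// mu_h_before//.
  by move=> -[].
exists f; split => // s.
by rewrite -fell height_ell -froot fi.
Qed.

Lemma codes_determined h t e : codes h -> 0 <= t <= total_mass mu -> 0 < e ->
  exists2 s, phi s <= t &
    forall v, phi s <= phi v -> phi v <= t -> `|mdist rho v - h t| < e.
Proof.
move=> ch tM e0; have [minh _] := ch; rewrite -(codes_zeta ch) in tM.
have [f [fell fh fs]] := codes_first_visit ch.
have [x xt xP] := height_determined minh tM e0.
have [s sx] := fs x; exists s; first by rewrite -fell sx.
by move=> v sv vt; rewrite -fh -fell; apply: xP; rewrite fell// -sx fell.
Qed.

Lemma height_ext (h1 h2 : height R) : zeta h1 = zeta h2 -> hval h1 =1 hval h2 -> h1 = h2.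
Proof.
case: h1 => z1 f1 a1 b1 c1 d1 e1 g1 i1 j1; case: h2 => z2 f2 a2 b2 c2 d2 e2 g2 i2 j2.
move=> /= ez /funext ef; subst; congr Height; exact: Prop_irrelevance.
Qed.

Lemma codes_unique h1 h2 : codes h1 -> codes h2 -> h1 = h2.
Proof.
move=> c1 c2; have z1 := codes_zeta c1; have z2 := codes_zeta c2.
apply: height_ext; first by rewrite z1 z2.
move=> t; have [tM|tM] := boolP (t \in `[0, total_mass mu]); last first.
  by rewrite !hval_out// ?z1 ?z2.
rewrite in_itv/= in tM.
apply/eqP; rewrite -subr_eq0 -normr_le0; apply/ler_addgt0Pr => e e0; rewrite add0r.
have e2 : 0 < e / 2 by lra.
have [s1 s1t s1P] := codes_determined c1 tM e2.
have [s2 s2t s2P] := codes_determined c2 tM e2.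
have [v [s1v s2v vt]] : exists v, [/\ phi s1 <= phi v, phi s2 <= phi v & phi v <= t].
  have [s12|/ltW s21] := leP (phi s1) (phi s2); [by exists s2|by exists s1].
have := s1P v s1v vt; have := s2P v s2v vt.
rewrite !ltr_norml ler_norml => /andP[a1 a2] /andP[b1 b2].
by apply/andP; split; lra.
Qed.

End Uniqueness.

(** * Existence and uniqueness *)

Lemma coding_height_codes (R : realType) (T : metricType R) (rho : T)
    (le : rel T) (mu : {finite_measure set (borel rho) -> \bar R})
    (treeT : real_tree T) (compT : compact [set: T]) (linle : linear_order le)
    (or1 : Or1 rho le) (or2 : Or2 rho le) (mes : Mes le mu) :
  codes le mu (coding_height treeT compT linle or1 or2 mes).
Proof.
split; first exact: min_coding.
exists (coding_map treeT compT linle or1 or2 mes); split.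
- exact: coding_map_dist.
- apply/seteqP; split => // y _.
  exists (position le mu (val (repr y))) => //.
  by rewrite coding_map_position p_h_repr.
- exact: coding_map_root.
- exact: le_coding.
- exact: mu_coding.
Qed.

Theorem theorem1p1 (R : realType) (T : metricType R) (rho : T) (le : rel T)
    (mu : {finite_measure set (borel rho) -> \bar R}) :
  real_tree T -> compact [set: T] -> linear_order le ->
  Or1 rho le -> Or2 rho le -> Mes le mu ->
  exists! h : height R,
    Min h /\ equivalent rho le mu (rho_h h) (@le_h R h) (@mu_h R h).
Proof.
move=> treeT compT linle or1 or2 mes.
have ch := coding_height_codes treeT compT linle or1 or2 mes.
exists (coding_height treeT compT linle or1 or2 mes); split => // h' ch'.
exact: (codes_unique treeT linle or1 or2 ch ch').
Qed.
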